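(* Let $a,b\in\mathbb{C}$, $r\in\mathbb{N}$, $\mathbf{m}=(m_1,\dots,m_r)\in\mathbb{N}^r$, $m=m_1+\cdots+m_r$, $\mathbf{f}=(f_1,\dots,f_r)\in\mathbb{C}^r$. Suppose $q\in\{0,\ldots,m-1\}$, $b+m-q\notin-\mathbb{N}_0$, and $f_j-b\notin\{m-q-m_j,m-q-m_j+1,\ldots,0\}$ for every index $1\le j\le r$ such that $m-q-m_j\le 0$. Then for all $x\in\mathbb{C}\setminus[1,\infty)$ $$(1-x)^{a}\,{}_{r+2}F_{r+1}\left(\begin{matrix}a,b,\mathbf{f}+\mathbf{m}\\ b+m-q,\mathbf{f}\end{matrix}\,\middle|\,x\right)=\sum_{j=0}^{q}\frac{(a)_j(-q)_jQ^{0}_m(-j)}{(b+m-q)_j\,j!}\left(\frac{x}{x-1}\right)^j$$ $$+\frac{x^{q+1}(a)_{q+1}R_{m-q-1}(-q-1)}{(x-1)^{q+1}(b+m-q)_{q+1}(m-q-1)!}\;{}_{m-q+1}F_{m-q}\left(\begin{matrix}1,a+q+1,\boldsymbol{\lambda}+q+2\\ b+m+1,\boldsymbol{\lambda}+q+1\end{matrix}\,\middle|\,\frac{x}{x-1}\right),$$ where $\boldsymbol{\lambda}=(\lambda_1,\ldots,\lambda_{m-q-1})$ are the zeros of the polynomial of degree $m-q-1$ $$R_{m-q-1}(t)=\sum_{k=0}^{m}(b)_kC_{k,r}(-1)^k(1-t-k)_{m-q-1},$$ the values $Q_m^0(-j)$, $0\le j\le q$, are $$Q_m^0(-j)=\frac{1}{(-q)_j}\sum_{k=0}^{j}(b)_kC_{k,r}(-j)_k(m-q)_{j-k},$$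 and the number $R_{m-q-1}(-q-1)$ is computed by $$R_{m-q-1}(-q-1)=(-1)^{m-q+1}\sum_{k=0}^{q+1}(b)_kC_{k,r}(-1)^k(k-m)_{m-q-1}.$$
   Context: $\mathbb{N}=\{1,2,\dots\}$, $\mathbb{N}_0=\mathbb{N}\cup\{0\}$; $(z)_k=z(z+1)\cdots(z+k-1)$, $(z)_0=1$. ${}_pF_q$ is the generalized hypergeometric function $\sum_{n\ge0}\frac{(a_1)_n\cdots(a_p)_n}{(b_1)_n\cdots(b_q)_n}\frac{z^n}{n!}$, and for $p=q+1$ it is understood as its analytic continuation to $z\in\mathbb{C}\setminus[1,\infty)$; as usual, no bottom parameter is a nonpositive integer (in particular no $f_j$ is). A vector in a parameter list stands for the list of its components: $\mathbf{f}+\mathbf{m}$ means $f_1+m_1,\dots,f_r+m_r$; $\boldsymbol{\lambda}+s$ means $\lambda_1+s,\dots,\lambda_{m-q-1}+s$ (an empty list if $m-q-1=0$). $(1-x)^a$ is the principal branch. The coefficients are $C_{k,r}=\frac{(-1)^k}{k!}\,{}_{r+1}F_r\left(\begin{matrix}-k,\mathbf{f}+\mathbf{m}\\ \mathbf{f}\end{matrix}\,\middle|\,1\right)=\frac{(-1)^k}{k!}\sum_{i=0}^k\frac{(-k)_i}{i!}\prod_{j=1}^r\frac{(f_j+m_j)_i}{(f_j)_i}$ for $0\le k\le m$; in particular $C_{0,r}=1$ and $C_{m,r}=1/\prod_{j=1}^r(f_j)_{m_j}$. ''The zeros $\lambda_1,\dots,\lambda_{m-q-1}$ of the polynomial $R_{m-q-1}$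 of degree $m-q-1$'' means that $R_{m-q-1}(t)=\kappa\prod_{i=1}^{m-q-1}(t-\lambda_i)$ with a nonzero constant $\kappa$. *)

(* Defs.v *)
From Stdlib Require Import Reals List ZArith.
From Coquelicot Require Import Coquelicot.
Open Scope C_scope.

Definition NtoC (n : nat) : C := RtoC (INR n).

Definition nonpos_int (z : C) : Prop := exists n : nat, z = - NtoC n.

(* The rising factorial (z)_k. *)
Fixpoint poch (z : C) (k : nat) : C :=
  match k with
  | O => 1
  | S j => poch z j * (z + NtoC j)
  end.

Definition Cprod (l : list C) : C := fold_right Cmult 1 l.

(* The list [u 1; ...; u r]: a vector (u_1,...,u_r) is represented by a function
   on nat of which only the values at 1,...,r are ever used. *)
Definition vec {T : Type} (u : nat -> T) (r : nat) : list T := map u (seq 1 r).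

Definition total (mm : nat -> nat) (r : nat) : nat := list_sum (vec mm r).

(* Principal argument, in (-PI, PI] for z <> 0. *)
Definition Carg (z : C) : R :=
  if Rle_dec 0 (Im z) then acos (Re z / Cmod z) else (- acos (Re z / Cmod z))%R.

Definition Clog (z : C) : C := (ln (Cmod z), Carg z).

Definition Cexp (z : C) : C :=
  ((exp (Re z) * cos (Im z))%R, (exp (Re z) * sin (Im z))%R).

(* The principal branch of z^a, for z <> 0. *)
Definition Cpower (z a : C) : C := Cexp (a * Clog z).

(* The slit plane: complex numbers outside [1, +oo). *)
Definition slit (z : C) : Prop := ~ (Im z = 0%R /\ (1 <= Re z)%R).

Definition analytic_at (F : C -> C) (z0 : C) : Prop :=
  exists (c : nat -> C) (d : posreal),
    forall h : C, (Cmod h < d)%R -> is_pseries c h (F (z0 + h)).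

Definition hyp_coef (top bot : list C) (n : nat) : C :=
  Cprod (map (fun c => poch c n) top)
  / (Cprod (map (fun c => poch c n) bot) * NtoC (fact n)).

(* F is, on the slit plane, the hypergeometric function with the given
   parameters (one more at the top than at the bottom): it is given by the
   hypergeometric series in the unit disk and is analytic on the slit plane.
   The slit plane is connected, so these conditions determine F on it; the
   values of F on [1, +oo) are irrelevant. *)
Definition is_hypergeom (top bot : list C) (F : C -> C) : Prop :=
  (forall z : C, (Cmod z < 1)%R -> is_pseries (hyp_coef top bot) z (F z)) /\
  (forall z : C, slit z -> analytic_at F z).

(* C_{k,r}; recall that [sum_n u k] is the sum of u 0, ..., u k. *)
Definition Ckr (r : nat) (mm : nat -> nat) (f : nat -> C) (k : nat) : C :=
  (- (1)) ^ k / NtoC (fact k) *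
  sum_n (fun i =>
    poch (- NtoC k) i / NtoC (fact i) *
    Cprod (vec (fun j => poch (f j + NtoC (mm j)) i / poch (f j) i) r)) k.

(* R_{m-q-1}(t), where m = m_1 + ... + m_r. *)
Definition Rpol (r : nat) (mm : nat -> nat) (f : nat -> C) (b : C) (q : nat)
    (t : C) : C :=
  let m := total mm r in
  sum_n (fun k =>
    poch b k * Ckr r mm f k * (- (1)) ^ k *
    poch (1 - t - NtoC k) (m - q - 1)) m.

(* The value Q^0_m(-j), for 0 <= j <= q. *)
Definition Q0neg (r : nat) (mm : nat -> nat) (f : nat -> C) (b : C) (q : nat)
    (j : nat) : C :=
  let m := total mm r in
  / poch (- NtoC q) j *
  sum_n (fun k =>
    poch b k * Ckr r mm f k * poch (- NtoC j) k *
    poch (NtoC m - NtoC q) (j - k)) j.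

(* Main.v *)
(* Put W(n) = prod_j (f_j+m_j)_n / (f_j)_n, a polynomial of degree m in n, and
   c = b+m-q. Pfaff's transformation y = x/(x-1) turns (1-x)^a F(x) into
   sum_j (a)_j/j! D_j y^j, where D_j is the j-th finite difference at 0 of
   n |-> (b)_n/(c)_n W(n). By the Leibniz rule for differences and Vandermonde's
   sum, D_j = (c)_j^{-1} sum_k (b)_k C_{k,r} (-j)_k (m-q)_{j-k}. For j <= q this is
   the coefficient of the finite sum; for j > q it is proportional to
   R_{m-q-1}(-j) / (c)_j, and factoring R_{m-q-1} gives the second series. The
   identity so obtained near 0 propagates along the segment [0,y] of the slit
   plane: Pfaff's transformation of a local expansion at any x0 is again an
   explicit power series in y - y0, so no general theorem on composition of
   analytic functions is needed. *)

(* With 1 - x = 1/(1 - y) one has (1 - x)^a x^n = (-1)^n y^n (1 - y)^(-a-n). Collecting powers of y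
   then produces the differences (1 - E)^j with no stray sign, which is why they are used rather
   than (E - 1)^j. The k-th difference of W at 0 is (-1)^k k! C_{k,r}, so C_{k,r} vanishes for k >
   m.

   The split at q arises as follows. For k <= j the factorials in (-j)_k (m-q)_{j-k} combine into a
   multiple of (1+j-k)_{m-q-1}, the polynomial that R_{m-q-1} contains at t = -j. But the sum in D_j
   stops at k = j and that in R_{m-q-1} at k = m. If j > q, each term with j < k <= m contains the
   factor 0, so the two sums agree.

   One local expansion serves twice: at y0 = 0 it identifies the coefficients, at the other points
   of the segment it gives analyticity of the left side. No branch correction appears, because w ->
   1/w maps the plane cut along (-oo, 0] to itself and negates the principal logarithm there. *)
Require Import Defs.
From Stdlib Require Import Reals List ZArith Lra Lia Classical.
From Coquelicot Require Import Coquelicot.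
Open Scope C_scope.

(** * Finite sums and rising factorials *)

(* [sum_n] typed in [C] rather than in the carrier of a monoid structure, so
   that [ring] applies. *)
Definition Csum (u : nat -> C) (n : nat) : C := sum_n u n.

Lemma Csum_O (u : nat -> C) : Csum u 0 = u 0%nat.
Proof. exact (sum_O u). Qed.

Lemma Csum_S (u : nat -> C) n : Csum u (S n) = Csum u n + u (S n).
Proof. exact (sum_Sn u n). Qed.

Lemma Csum_ext (u v : nat -> C) n :
  (forall k, (k <= n)%nat -> u k = v k) -> Csum u n = Csum v n.
Proof. exact (sum_n_ext_loc u v n). Qed.

Lemma Csum_plus (u v : nat -> C) n :
  Csum (fun k => u k + v k) n = Csum u n + Csum v n.
Proof. exact (sum_n_plus u v n). Qed.

Lemma Csum_scal (x : C) (u : nat -> C) n :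
  Csum (fun k => x * u k) n = x * Csum u n.
Proof. exact (sum_n_mult_l (K := C_Ring) x u n). Qed.

Lemma Csum_S_left (u : nat -> C) n :
  Csum u (S n) = u 0%nat + Csum (fun k => u (S k)) n.
Proof.
  induction n as [|n IH].
  - now rewrite Csum_S, !Csum_O.
  - rewrite Csum_S, IH, (Csum_S (fun k => u (S k))). ring.
Qed.

Lemma Csum_trunc (u : nat -> C) n p :
  (forall k, (n < k)%nat -> u k = 0) -> Csum u (n + p) = Csum u n.
Proof.
  intros Hu. induction p as [|p IH].
  - now rewrite Nat.add_0_r.
  - rewrite Nat.add_succ_r, Csum_S, IH, Hu by lia. ring.
Qed.

Lemma NtoC_S n : NtoC (S n) = NtoC n + 1.
Proof. unfold NtoC. rewrite S_INR, RtoC_plus. reflexivity. Qed.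

Lemma NtoC_plus n p : NtoC (n + p) = NtoC n + NtoC p.
Proof. unfold NtoC. rewrite plus_INR, RtoC_plus. reflexivity. Qed.

Lemma NtoC_mult n p : NtoC (n * p) = NtoC n * NtoC p.
Proof. unfold NtoC. rewrite mult_INR, RtoC_mult. reflexivity. Qed.

Lemma NtoC_minus n p : (p <= n)%nat -> NtoC (n - p) = NtoC n - NtoC p.
Proof. intros H. unfold NtoC. rewrite minus_INR, RtoC_minus by lia. reflexivity. Qed.

Lemma NtoC_neq_0 n : (0 < n)%nat -> NtoC n <> 0.
Proof.
  intros H E. apply (f_equal fst) in E. simpl in E.
  apply (not_0_INR n); [lia | exact E].
Qed.

Lemma NtoC_fact_neq_0 n : NtoC (fact n) <> 0.
Proof. apply NtoC_neq_0, lt_O_fact. Qed.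

Lemma NtoC_fact_S n : NtoC (fact (S n)) = (NtoC n + 1) * NtoC (fact n).
Proof.
  change (fact (S n)) with (S n * fact n)%nat. now rewrite NtoC_mult, NtoC_S.
Qed.

Lemma poch_S z n : poch z (S n) = poch z n * (z + NtoC n).
Proof. reflexivity. Qed.

Lemma poch_S_left z n : poch z (S n) = z * poch (z + 1) n.
Proof.
  induction n as [|n IH].
  - simpl. change (NtoC 0) with (RtoC 0). ring.
  - rewrite poch_S, IH, poch_S, NtoC_S. ring.
Qed.

Lemma poch_plus z n p : poch z (n + p) = poch z n * poch (z + NtoC n) p.
Proof.
  induction p as [|p IH].
  - rewrite Nat.add_0_r. simpl. ring.
  - rewrite Nat.add_succ_r, !poch_S, IH, NtoC_plus. ring.
Qed.

Lemma poch_neq_0 z n : ~ nonpos_int z -> poch z n <> 0.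
Proof.
  intros Hz. induction n as [|n IH].
  - simpl. intros E. apply (f_equal fst) in E. simpl in E. lra.
  - rewrite poch_S. apply Cmult_neq_0; [exact IH|].
    intros E. apply Hz. exists n.
    replace z with ((z + NtoC n) - NtoC n) by ring. rewrite E. ring.
Qed.

Lemma nonpos_int_shift z n : ~ nonpos_int z -> ~ nonpos_int (z + NtoC n).
Proof.
  intros Hz [p Hp]. apply Hz. exists (n + p)%nat.
  rewrite NtoC_plus. replace z with ((z + NtoC n) - NtoC n) by ring.
  rewrite Hp. ring.
Qed.

Lemma poch_opp_nat_zero n p : (n < p)%nat -> poch (- NtoC n) p = 0.
Proof.
  intros H. replace p with (S n + (p - S n))%nat by lia.
  rewrite poch_plus, poch_S. ring.
Qed.

Lemma poch_opp_nat_neq_0 n p : (p <= n)%nat -> poch (- NtoC n) p <> 0.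
Proof.
  induction p as [|p IH]; intros H.
  - simpl. intros E. apply (f_equal fst) in E. simpl in E. lra.
  - rewrite poch_S. apply Cmult_neq_0; [apply IH; lia|].
    replace (- NtoC n + NtoC p) with (- NtoC (n - p))
      by (rewrite NtoC_minus by lia; ring).
    intros E. apply (NtoC_neq_0 (n - p)); [lia|].
    replace (NtoC (n - p)) with (- - NtoC (n - p)) by ring. rewrite E. ring.
Qed.

Lemma poch_reflect z n : poch z n = (- (1)) ^ n * poch (1 - z - NtoC n) n.
Proof.
  revert z. induction n as [|n IH]; intros z.
  - simpl. ring.
  - rewrite poch_S_left, IH, poch_S, Cpow_S, NtoC_S.
    replace (1 - (z + 1) - NtoC n) with (1 - z - (NtoC n + 1)) by ring. ring.
Qed.

Lemma poch_nat_fact p n :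
  poch (NtoC p + 1) n = NtoC (fact (p + n)) / NtoC (fact p).
Proof.
  induction n as [|n IH].
  - rewrite Nat.add_0_r. simpl. field. apply NtoC_fact_neq_0.
  - rewrite poch_S, IH, Nat.add_succ_r, NtoC_fact_S, NtoC_plus.
    field. apply NtoC_fact_neq_0.
Qed.

Lemma poch_opp_nat_fact n p : (p <= n)%nat ->
  poch (- NtoC n) p = (- (1)) ^ p * NtoC (fact n) / NtoC (fact (n - p)).
Proof.
  intros H. rewrite poch_reflect.
  replace (1 - - NtoC n - NtoC p) with (NtoC (n - p) + 1)
    by (rewrite NtoC_minus by lia; ring).
  rewrite poch_nat_fact. replace (n - p + p)%nat with n by lia.
  unfold Cdiv. ring.
Qed.

(** * Finite differences *)

(* [fdiff k w] is (1 - E)^k w at 0, where E is the shift. *)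
Fixpoint fdiff (k : nat) (w : nat -> C) : C :=
  match k with
  | O => w 0%nat
  | S k' => fdiff k' w - fdiff k' (fun n => w (S n))
  end.

Lemma fdiff_ext k u v : (forall n, u n = v n) -> fdiff k u = fdiff k v.
Proof.
  revert u v. induction k as [|k IH]; intros u v H; simpl.
  - apply H.
  - rewrite (IH u v), (IH (fun n => u (S n)) (fun n => v (S n))); auto.
Qed.

Lemma fdiff_plus k u v : fdiff k (fun n => u n + v n) = fdiff k u + fdiff k v.
Proof.
  revert u v. induction k as [|k IH]; intros u v; simpl.
  - reflexivity.
  - rewrite IH, (IH (fun n => u (S n))). ring.
Qed.

Lemma fdiff_scal k x u : fdiff k (fun n => x * u n) = x * fdiff k u.
Proof.
  revert u. induction k as [|k IH]; intros u; simpl.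
  - reflexivity.
  - rewrite IH, (IH (fun n => u (S n))). ring.
Qed.

(** Binomial expansion of (1 - E)^k, since (-k)_i / i! = (-1)^i binom(k,i). In this form the sum
    defining C_{k,r} is recognised as a difference. *)
Lemma fdiff_sum k w :
  fdiff k w = Csum (fun i => poch (- NtoC k) i / NtoC (fact i) * w i) k.
Proof.
  revert w. induction k as [|k IH]; intros w.
  - rewrite Csum_O. simpl. change (NtoC 1) with (RtoC 1). field.
  - simpl fdiff. rewrite (IH w), (IH (fun n => w (S n))), Csum_S_left.
    set (B := fun i => poch (- NtoC k) i / NtoC (fact i)).
    (* Pascal's rule for the signed binomial coefficients. *)
    assert (HP : forall i,
      poch (- NtoC (S k)) (S i) / NtoC (fact (S i)) = B (S i) - B i).
    { intros i. unfold B. rewrite poch_S_left, NtoC_fact_S, NtoC_S, poch_S.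
      replace (- (NtoC k + 1) + 1) with (- NtoC k) by ring.
      field. split; [apply NtoC_fact_neq_0|].
      rewrite <- NtoC_S. apply NtoC_neq_0; lia. }
    rewrite (Csum_ext (fun i => poch (- NtoC (S k)) (S i) / NtoC (fact (S i)) * w (S i))
      (fun i => B (S i) * w (S i) + (- (1)) * (B i * w (S i))))
      by (intros i _; rewrite HP; ring).
    rewrite Csum_plus, Csum_scal.
    change (Csum (fun i => B i * w i) k - Csum (fun i => B i * w (S i)) k =
      poch (- NtoC (S k)) 0 / NtoC (fact 0) * w 0%nat +
      (Csum (fun i => B (S i) * w (S i)) k +
       - (1) * Csum (fun i => B i * w (S i)) k)).
    (* The sum may be extended to i = k+1, because (-k)_{k+1} = 0. *)
    assert (HS : Csum (fun i => B i * w i) k =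
      B 0%nat * w 0%nat + Csum (fun i => B (S i) * w (S i)) k).
    { rewrite <- (Csum_S_left (fun i => B i * w i)), Csum_S.
      unfold B at 3. rewrite poch_opp_nat_zero by lia. unfold Cdiv. ring. }
    rewrite HS. unfold B at 1. simpl poch. ring.
Qed.

(** As operators, (1 - E)^(k+1) n = n (1 - E)^(k+1) - (k+1) E (1 - E)^k; at n = 0 the first term
    disappears. *)
Lemma fdiff_id_mult k w :
  fdiff (S k) (fun n => NtoC n * w n) =
  - (NtoC k + 1) * fdiff k (fun n => w (S n)).
Proof.
  revert w. induction k as [|k IH]; intros w.
  - simpl. change (NtoC 0) with (RtoC 0). change (NtoC 1) with (RtoC 1). ring.
  - change (fdiff (S (S k)) (fun n => NtoC n * w n)) with
      (fdiff (S k) (fun n => NtoC n * w n)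
       - fdiff (S k) (fun n => NtoC (S n) * w (S n))).
    rewrite (fdiff_ext (S k) (fun n => NtoC (S n) * w (S n))
      (fun n => NtoC n * w (S n) + w (S n)))
      by (intros n; rewrite NtoC_S; ring).
    rewrite fdiff_plus, IH, (IH (fun n => w (S n))), NtoC_S.
    simpl. ring.
Qed.

(** Degree at most d is expressed by the vanishing of all differences at 0 of order above d; a
    linear factor raises the bound by one. *)
Lemma fdiff_linear_factor d w z :
  (forall k, (d < k)%nat -> fdiff k w = 0) ->
  forall k, (S d < k)%nat -> fdiff k (fun n => (z + NtoC n) * w n) = 0.
Proof.
  intros Hw [|k] Hk; [lia|].
  rewrite (fdiff_ext _ _ (fun n => z * w n + NtoC n * w n)) by (intros; ring).
  rewrite fdiff_plus, fdiff_scal, fdiff_id_mult, Hw by lia.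
  (* E = 1 - (1 - E) brings the shifted difference back to differences at 0. *)
  assert (E : fdiff k (fun n => w (S n)) = fdiff k w - fdiff (S k) w)
    by (simpl; ring).
  rewrite E, !Hw by lia. ring.
Qed.

(* Leibniz: 1 - E_u E_w = (1 - E_u) + E_u (1 - E_w). *)
Lemma fdiff_mult j u w :
  fdiff j (fun n => u n * w n) =
  Csum (fun k => (- (1)) ^ k * (poch (- NtoC j) k / NtoC (fact k)) *
    fdiff k w * fdiff (j - k) (fun n => u (k + n)%nat)) j.
Proof.
  revert u w. induction j as [|j IH]; intros u w.
  - rewrite Csum_O. simpl. change (NtoC 1) with (RtoC 1). field.
  (* The plain binomial coefficient binom(i,k): the power of -1 cancels the sign of (-i)_k. *)
  - set (B := fun i k => (- (1)) ^ k * (poch (- NtoC i) k / NtoC (fact k))).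
    change (fdiff (S j) (fun n => u n * w n)) with
      (fdiff j (fun n => u n * w n) -
       fdiff j (fun n => u (S n) * w (S n))).
    rewrite IH, (IH (fun n => u (S n)) (fun n => w (S n))), Csum_S_left.
    assert (HP : forall k, B (S j) (S k) = B j (S k) + B j k).
    { intros k. unfold B.
      rewrite poch_S_left, NtoC_fact_S, NtoC_S, poch_S, Cpow_S.
      replace (- (NtoC j + 1) + 1) with (- NtoC j) by ring.
      field. split; [apply NtoC_fact_neq_0|].
      rewrite <- NtoC_S. apply NtoC_neq_0; lia. }
    (* In [X] the additional difference falls on [u]; in [Y] it falls on [w] and [u] is shifted once
       more. *)
    set (X := fun k => B j k * fdiff k w * fdiff (S j - k) (fun n => u (k + n)%nat)).
    set (Y := fun k => B j k * fdiff (S k) w * fdiff (j - k) (fun n => u (S k + n)%nat)).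
    transitivity (Csum (fun k => X k + Y k) j).
    { match goal with |- ?s1 - ?s2 = _ =>
        replace (s1 - s2) with (s1 + (- (1)) * s2) by ring end.
      rewrite <- Csum_scal, <- Csum_plus. apply Csum_ext. intros k Hk.
      unfold X, Y, B. replace (S j - k)%nat with (S (j - k)) by lia.
      simpl fdiff.
      rewrite (fdiff_ext (j - k) (fun n => u (k + S n)%nat) (fun n => u (S (k + n))))
        by (intros n; f_equal; lia).
      ring. }
    rewrite Csum_plus.
    assert (HX : Csum X j = X 0%nat + Csum (fun k => X (S k)) j).
    { rewrite <- Csum_S_left, Csum_S. unfold X at 3, B.
      rewrite poch_opp_nat_zero by lia. unfold Cdiv. ring. }
    rewrite HX, <- Cplus_assoc, <- Csum_plus.
    f_equal.
    apply Csum_ext. intros k Hk.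
    change (X (S k) + Y k =
      B (S j) (S k) * fdiff (S k) w * fdiff (S j - S k) (fun n => u (S k + n)%nat)).
    rewrite HP. unfold X, Y.
    change (S j - S k)%nat with (j - k)%nat. ring.
Qed.

(** The Chu-Vandermonde sum. Shifting (b)_i/(c)_i gives b/c times the same quotient for b+1, c+1,
    and c - b is unchanged, so the induction runs over all b and c. *)
Lemma vandermonde n b c : ~ nonpos_int c ->
  fdiff n (fun i => poch b i / poch c i) = poch (c - b) n / poch c n.
Proof.
  revert b c. induction n as [|n IH]; intros b c Hc.
  - reflexivity.
  - assert (Hc1 : ~ nonpos_int (c + 1)).
    { replace (c + 1) with (c + NtoC 1) by reflexivity.
      now apply nonpos_int_shift. }
    assert (c0 : c <> 0).
    { intros E. apply Hc. exists 0%nat. rewrite E. change (NtoC 0) with (RtoC 0). ring. }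
    simpl fdiff. rewrite IH by exact Hc.
    rewrite (fdiff_ext n (fun i => poch b i * (b + NtoC i) / (poch c i * (c + NtoC i)))
      (fun i => b / c * (poch (b + 1) i / poch (c + 1) i))).
    + rewrite fdiff_scal, IH by exact Hc1.
      replace (c + 1 - (b + 1)) with (c - b) by ring.
      assert (E : poch (c + 1) n = poch c n * (c + NtoC n) / c).
      { rewrite <- poch_S, poch_S_left. now field. }
      assert (H1 := poch_neq_0 c n Hc).
      assert (H2 := poch_neq_0 c (S n) Hc). rewrite poch_S in H2.
      assert (c + NtoC n <> 0) by (intros E'; apply H2; rewrite E'; ring).
      rewrite E, !poch_S. field. repeat split; assumption.
    + intros i. rewrite <- !poch_S, !poch_S_left.
      field. split; [now apply poch_neq_0 | exact c0].
Qed.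

(** * Complex series *)

Definition Cser (u : nat -> C) (l : C) : Prop :=
  @is_series C_AbsRing C_NormedModule u l.

Lemma Csum_fst u n : fst (Csum u n) = sum_n (fun k => fst (u k)) n.
Proof.
  induction n as [|n IH].
  - now rewrite Csum_O, sum_O.
  - rewrite Csum_S, sum_Sn, <- IH. reflexivity.
Qed.

Lemma Csum_snd u n : snd (Csum u n) = sum_n (fun k => snd (u k)) n.
Proof.
  induction n as [|n IH].
  - now rewrite Csum_O, sum_O.
  - rewrite Csum_S, sum_Sn, <- IH. reflexivity.
Qed.

Lemma Cmod_Csum_le u n : (Cmod (Csum u n) <= sum_n (fun k => Cmod (u k)) n)%R.
Proof. exact (norm_sum_n_m (V := C_NormedModule) u 0 n). Qed.

Lemma Cser_iff u l : Cser u l <-> is_lim_seq (fun n => Cmod (Csum u n - l)) 0.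
Proof.
  unfold Cser, is_series. rewrite (filterlim_locally_ball_norm (U := C_NormedModule)).
  split.
  - intros H. apply is_lim_seq_spec. intros eps.
    destruct (H eps) as [N HN]. exists N. intros n Hn.
    rewrite Rminus_0_r, Rabs_pos_eq by apply Cmod_ge_0.
    exact (HN n Hn).
  - intros H eps. apply is_lim_seq_spec in H.
    destruct (H eps) as [N HN]. exists N. intros n Hn.
    specialize (HN n Hn).
    rewrite Rminus_0_r, Rabs_pos_eq in HN by apply Cmod_ge_0.
    exact HN.
Qed.

Lemma is_lim_seq_squeeze_0 (u v : nat -> R) :
  (forall n, 0 <= u n <= v n)%R -> is_lim_seq v 0 -> is_lim_seq u 0.
Proof.
  intros H Hv. apply is_lim_seq_le_le with (fun _ => 0%R) v; auto.
  apply is_lim_seq_const.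
Qed.

Lemma is_series_R_iff (u : nat -> R) l :
  is_series u l <-> is_lim_seq (fun n => Rabs (sum_n u n - l)) 0.
Proof.
  split; intros H.
  - change (is_lim_seq (sum_n u) l) in H.
    apply (is_lim_seq_abs_0 (fun n => sum_n u n - l)%R).
    replace (Finite 0) with (Finite (l - l)) by (f_equal; ring).
    apply is_lim_seq_minus'; [exact H | apply is_lim_seq_const].
  - change (is_lim_seq (sum_n u) l).
    apply (is_lim_seq_abs_0 (fun n => sum_n u n - l)%R) in H.
    apply is_lim_seq_ext with (fun n => (sum_n u n - l) + l)%R; [intros; ring|].
    replace (Finite l) with (Finite (0 + l)) by (f_equal; ring).
    apply is_lim_seq_plus'; [exact H | apply is_lim_seq_const].
Qed.

Lemma Cmod_le_sum (z : C) : (Cmod z <= Rabs (fst z) + Rabs (snd z))%R.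
Proof.
  replace z with ((fst z, 0%R) + (0%R, snd z))
    by (destruct z as [x y]; unfold Cplus; simpl; f_equal; ring).
  eapply Rle_trans; [apply Cmod_triangle|].
  apply Req_le. unfold Cplus; simpl fst; simpl snd.
  rewrite !Rplus_0_l, !Rplus_0_r. f_equal.
  - apply (Cmod_R (fst z)).
  - unfold Cmod; simpl. rewrite <- sqrt_Rsqr_abs. f_equal. unfold Rsqr. ring.
Qed.

Lemma Cser_components u l :
  Cser u l <-> is_series (fun n => fst (u n)) (fst l) /\
               is_series (fun n => snd (u n)) (snd l).
Proof.
  rewrite Cser_iff, !is_series_R_iff.
  assert (E1 : forall n, fst (Csum u n - l) = (sum_n (fun k => fst (u k)) n - fst l)%R)
    by (intros n; rewrite <- Csum_fst; reflexivity).
  assert (E2 : forall n, snd (Csum u n - l) = (sum_n (fun k => snd (u k)) n - snd l)%R)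
    by (intros n; rewrite <- Csum_snd; reflexivity).
  split.
  - intros H. split; apply is_lim_seq_squeeze_0 with (2 := H); intros n;
      (split; [apply Rabs_pos|]).
    + rewrite <- E1. eapply Rle_trans; [|apply Rmax_Cmod]. apply Rmax_l.
    + rewrite <- E2. eapply Rle_trans; [|apply Rmax_Cmod]. apply Rmax_r.
  - intros [H1 H2].
    apply is_lim_seq_squeeze_0 with
      (fun n => Rabs (sum_n (fun k => fst (u k)) n - fst l) +
                Rabs (sum_n (fun k => snd (u k)) n - snd l))%R.
    + intros n. split; [apply Cmod_ge_0|]. rewrite <- E1, <- E2.
      apply Cmod_le_sum.
    + replace (Finite 0) with (Finite (0 + 0)) by (f_equal; ring).
      now apply is_lim_seq_plus'.
Qed.

Lemma Cser_unique u l l' : Cser u l -> Cser u l' -> l = l'.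
Proof.
  intros H H'. apply Cser_components in H, H'.
  destruct l as [l1 l2], l' as [l1' l2'].
  destruct H as [H1 H2], H' as [H1' H2']. simpl in *.
  apply is_series_unique in H1, H2, H1', H2'. congruence.
Qed.

Lemma Cser_ext (u v : nat -> C) l : (forall n, u n = v n) -> Cser u l -> Cser v l.
Proof. exact (is_series_ext u v l). Qed.

Lemma Cser_plus u v lu lv :
  Cser u lu -> Cser v lv -> Cser (fun n => u n + v n) (lu + lv).
Proof. exact (is_series_plus u v lu lv). Qed.

Lemma Cser_scal x u l : Cser u l -> Cser (fun n => x * u n) (x * l).
Proof. exact (is_series_scal (K := C_AbsRing) (V := C_NormedModule) x u l). Qed.

Lemma Cser_minus u v lu lv :
  Cser u lu -> Cser v lv -> Cser (fun n => u n - v n) (lu - lv).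
Proof. exact (is_series_minus (V := C_NormedModule) u v lu lv). Qed.

Lemma Cser_shift u l : Cser u l <-> Cser (fun n => u (S n)) (l - u 0%nat).
Proof.
  split; intros H.
  - apply (is_series_incr_1 (V := C_NormedModule) u).
    change (plus (l - u 0%nat) (u 0%nat)) with (l - u 0%nat + u 0%nat).
    now replace (l - u 0%nat + u 0%nat) with l by ring.
  - apply (is_series_decr_1 (V := C_NormedModule) u). exact H.
Qed.

(** [Csum u n] includes the term of index n, so the tail starts at n + 1. *)
Lemma Cser_shift_n n u l :
  Cser u (Csum u n + l) <-> Cser (fun i => u (n + S i)%nat) l.
Proof.
  revert l. induction n as [|n IH]; intros l.
  - rewrite Cser_shift, Csum_O. replace (u 0%nat + l - u 0%nat) with l by ring.
    reflexivity.
  - rewrite Csum_S, <- Cplus_assoc, IH, Cser_shift.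
    replace (n + 1)%nat with (S n) by lia.
    replace (u (S n) + l - u (S n)) with l by ring.
    split; apply Cser_ext; intros i; f_equal; lia.
Qed.

Lemma is_pseries_Cser (c : nat -> C) (h l : C) :
  is_pseries c h l <-> Cser (fun n => h ^ n * c n) l.
Proof.
  assert (E : forall n, pow_n (K := C_AbsRing) h n = h ^ n).
  { induction n as [|n IH]; [reflexivity|].
    exact (f_equal (Cmult h) IH). }
  assert (E' : forall n, scal (pow_n (K := C_AbsRing) h n) (c n) = h ^ n * c n)
    by (intros n; exact (f_equal (fun z => z * c n) (E n))).
  unfold is_pseries. split; apply is_series_ext; intros n; [|symmetry]; apply E'.
Qed.

Lemma geom_half_bounded_ex (B : R) : ex_series (fun n => B * (/ 2) ^ n)%R.
Proof.
  apply (ex_series_scal (V := R_NormedModule) B (fun n => (/ 2) ^ n)%R). exists (/ (1 - / 2))%R. apply is_series_geom.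
  rewrite Rabs_pos_eq; lra.
Qed.

Lemma Cser_geom_ex (u : nat -> C) B :
  (forall n, Cmod (u n) <= B * (/ 2) ^ n)%R -> exists l, Cser u l.
Proof.
  intros H.
  apply (ex_series_le (V := C_CompleteNormedModule) u (fun n => B * (/ 2) ^ n)%R).
  - exact H.
  - apply geom_half_bounded_ex.
Qed.

Lemma Cser_terms_bounded u l :
  Cser u l -> exists B, (0 < B)%R /\ forall n, (Cmod (u n) <= B)%R.
Proof.
  intros H.
  apply Cser_iff in H. apply is_lim_seq_spec in H.
  destruct (H (mkposreal 1 Rlt_0_1)) as [N HN]. simpl in HN.
  (* A late term is the difference of two partial sums, each within 1 of the limit. *)
  assert (HN' : forall n, (S N <= n)%nat -> (Cmod (u n) <= 2)%R).
  { intros [|n] Hn; [lia|].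
    assert (H1 := HN n ltac:(lia)). assert (H2 := HN (S n) ltac:(lia)).
    rewrite Rminus_0_r, Rabs_pos_eq in H1, H2 by apply Cmod_ge_0.
    replace (u (S n)) with ((Csum u (S n) - l) - (Csum u n - l))
      by (rewrite Csum_S; ring).
    eapply Rle_trans; [apply Cmod_triangle|]. rewrite Cmod_opp. lra. }
  assert (Hfin : forall N, exists B, (0 < B)%R /\ forall n, (n < N)%nat -> (Cmod (u n) <= B)%R).
  { clear. induction N as [|N [B [HB IH]]].
    - exists 1%R. split; [lra | lia].
    - exists (B + Cmod (u N))%R. split; [generalize (Cmod_ge_0 (u N)); lra|].
      intros n Hn. destruct (Nat.eq_dec n N) as [->|Hne]; [lra|].
      apply Rle_trans with B; [apply IH; lia | generalize (Cmod_ge_0 (u N)); lra]. }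
  destruct (Hfin (S N)) as [B [HB HB']].
  exists (B + 2)%R. split; [lra|]. intros n.
  destruct (Nat.lt_ge_cases n (S N)) as [Hn|Hn].
  - specialize (HB' n Hn). lra.
  - specialize (HN' n Hn). lra.
Qed.

(** Stated over an arbitrary commutative monoid so that it applies to the complex terms as well as
    to their real majorants. *)
Lemma triangle_rows (G : AbelianMonoid) (T : nat -> nat -> G) n :
  sum_n (fun j => sum_n (fun i => T i (j - i)%nat) j) n =
  sum_n (fun i => sum_n (T i) (n - i)) n.
Proof.
  induction n as [|n IH].
  - now rewrite !sum_O.
  - rewrite sum_Sn, IH, (sum_Sn (fun i => sum_n (T i) (S n - i))).
    rewrite (sum_Sn (fun i => T i (S n - i)%nat)), Nat.sub_diag, sum_O.
    rewrite plus_assoc, <- sum_n_plus. f_equal.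
    apply sum_n_ext_loc. intros i Hi.
    replace (S n - i)%nat with (S (n - i)) by lia. now rewrite sum_Sn.
Qed.

Lemma series_remainder_le (t : nat -> C) (row : C) (rho : nat -> R) (A P : R) M :
  (0 <= A)%R -> (forall n, 0 <= rho n)%R ->
  (forall n, Cmod (t n) <= A * rho n)%R ->
  is_series rho P -> Cser t row ->
  (Cmod (row - Csum t M) <= A * (P - sum_n rho M))%R.
Proof.
  intros HA Hrho Ht HP Hrow.
  assert (Hle : forall p, (sum_n rho (M + p) <= P)%R).
  { intros p. change (is_lim_seq (sum_n rho) P) in HP.
    apply (is_lim_seq_incr_compare (sum_n rho) P HP).
    intros n. rewrite sum_Sn. unfold plus; simpl. specialize (Hrho (S n)). lra. }
  assert (Hd : forall p,
    (Cmod (Csum t (M + p) - Csum t M) <= A * (sum_n rho (M + p) - sum_n rho M))%R).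
  { induction p as [|p IH].
    - rewrite Nat.add_0_r. replace (Csum t M - Csum t M) with (RtoC 0) by ring.
      rewrite Cmod_0. lra.
    - rewrite Nat.add_succ_r, Csum_S, sum_Sn. unfold plus; simpl.
      replace (Csum t (M + p) + t (S (M + p)) - Csum t M) with
        ((Csum t (M + p) - Csum t M) + t (S (M + p))) by ring.
      eapply Rle_trans; [apply Cmod_triangle|].
      specialize (Ht (S (M + p))). lra. }
  apply Cser_iff in Hrow.
  apply le_epsilon. intros eps Heps.
  apply is_lim_seq_spec in Hrow. destruct (Hrow (mkposreal eps Heps)) as [N HN].
  specialize (HN (M + N)%nat ltac:(lia)). simpl in HN.
  rewrite Rminus_0_r, Rabs_pos_eq in HN by apply Cmod_ge_0.
  replace (row - Csum t M) with
    (- (Csum t (M + N) - row) + (Csum t (M + N) - Csum t M)) by ring.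
  eapply Rle_trans; [apply Cmod_triangle|]. rewrite Cmod_opp.
  specialize (Hd N). specialize (Hle N).
  assert (A * (sum_n rho (M + N) - sum_n rho M) <= A * (P - sum_n rho M))%R
    by (apply Rmult_le_compat_l; lra).
  lra.
Qed.

(* The error made by summing over the triangle i + l <= n instead of over full
   rows is at most the product of the sums of alpha and rho minus the partial
   sum of their Cauchy product. *)
Lemma triangle_sum (T : nat -> nat -> C) (alpha rho : nat -> R) (row : nat -> C) S :
  (forall n, 0 <= alpha n)%R -> (forall n, 0 <= rho n)%R ->
  (forall n l, Cmod (T n l) <= alpha n * rho l)%R ->
  ex_series alpha -> ex_series rho ->
  (forall n, Cser (T n) (row n)) -> Cser row S ->
  Cser (fun j => Csum (fun n => T n (j - n)%nat) j) S.
Proof.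
  intros Ha Hr HT [A HA] [P HP] Hrow HS.
  apply Cser_iff in HS. apply Cser_iff.
  (* The Cauchy product of the majorants converges to the product of their sums; hence the error [E]
     below tends to A P - A P = 0. *)
  assert (Hprod : is_series (fun n => sum_n (fun k => alpha k * rho (n - k)%nat)%R n) (A * P)%R).
  { assert (Hpos : forall u : nat -> R, (forall n, 0 <= u n)%R -> forall l, is_series u l ->
      ex_series (fun n => Rabs (u n))).
    { intros u Hu l Hl. exists l. apply is_series_ext with u; [|exact Hl].
      intros n. symmetry. now apply Rabs_pos_eq. }
    apply is_series_ext with (2 := is_series_mult alpha rho A P HA HP
      (Hpos _ Ha _ HA) (Hpos _ Hr _ HP)).
    intros n. now rewrite sum_n_Reals. }
  set (E := fun n => (sum_n alpha n * P -
    sum_n (fun j => sum_n (fun k => alpha k * rho (j - k)%nat)%R j) n)%R).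
  apply is_lim_seq_squeeze_0 with (fun n => E n + Cmod (Csum row n - S))%R.
  - intros n. split; [apply Cmod_ge_0|].
    assert (H1 : Csum (fun j => Csum (fun i => T i (j - i)%nat) j) n =
      Csum (fun i => Csum (T i) (n - i)) n) by exact (triangle_rows _ T n).
    rewrite H1.
    replace (Csum (fun i => Csum (T i) (n - i)) n - S) with
      (- (Csum (fun i => row i - Csum (T i) (n - i)) n) + (Csum row n - S)).
    + eapply Rle_trans; [apply Cmod_triangle|]. rewrite Cmod_opp.
      apply Rplus_le_compat_r.
      eapply Rle_trans; [apply Cmod_Csum_le|].
      unfold E. rewrite (triangle_rows R_AbelianMonoid (fun i l => alpha i * rho l)%R).
      replace (sum_n alpha n * P - sum_n (fun i => sum_n (fun l => alpha i * rho l)%R (n - i)) n)%R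
        with (sum_n (fun i => alpha i * (P - sum_n rho (n - i)))%R n).
      * apply sum_n_m_le. intros i.
        apply series_remainder_le; auto.
      * clear -P. set (g := fun i => sum_n (fun l : nat => (alpha i * rho l)%R) (n - i)).
        assert (Hg : forall i, g i = (alpha i * sum_n rho (n - i))%R)
          by (intros i; apply (sum_n_mult_l (K := R_Ring) (alpha i) rho)).
        rewrite (sum_n_ext (fun i => alpha i * (P - sum_n rho (n - i)))%R
          (fun i => P * alpha i + (-1) * g i)%R)
          by (intros i; rewrite Hg; simpl; ring).
        rewrite (sum_n_plus (G := R_AbelianMonoid)
          (fun i => P * alpha i)%R (fun i => (-1) * g i)%R).
        rewrite (sum_n_mult_l (K := R_Ring) P alpha),
          (sum_n_mult_l (K := R_Ring) (-1)%R g).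
        change (P * sum_n alpha n + -1 * sum_n g n = sum_n alpha n * P - sum_n g n)%R.
        ring.
    + rewrite (Csum_ext (fun i => row i - Csum (T i) (n - i))
        (fun i => row i + (- (1)) * Csum (T i) (n - i)))
        by (intros; ring).
      rewrite Csum_plus, Csum_scal. ring.
  - replace (Finite 0) with (Finite ((A * P - A * P) + 0)) by (f_equal; ring).
    apply is_lim_seq_plus'; [|exact HS].
    apply is_lim_seq_minus'; [|exact Hprod].
    apply is_lim_seq_mult'; [exact HA | apply is_lim_seq_const].
Qed.

(** * The principal logarithm on the cut plane *)

(* C minus the half-line (-oo, 0]; this form makes openness quantitative, since
   |w| + Re w is 2-Lipschitz. *)
Definition cut_plane (w : C) : Prop := (0 < Cmod w + Re w)%R.

Lemma Cmod_sqr (w : C) : (Cmod w * Cmod w = Re w * Re w + Im w * Im w)%R.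
Proof.
  unfold Cmod, Re, Im. rewrite sqrt_sqrt; [ring|].
  generalize (pow2_ge_0 (fst w)) (pow2_ge_0 (snd w)). lra.
Qed.

Lemma Re_Cinv w : Re (/ w) = (Re w / (Cmod w * Cmod w))%R.
Proof.
  rewrite Cmod_sqr. unfold Re, Im, Cinv. simpl. now rewrite !Rmult_1_r.
Qed.

Lemma Im_Cinv w : Im (/ w) = (- Im w / (Cmod w * Cmod w))%R.
Proof.
  rewrite Cmod_sqr. unfold Re, Im, Cinv. simpl. now rewrite !Rmult_1_r.
Qed.

Lemma cut_plane_iff w : cut_plane w <-> ~ (Im w = 0%R /\ (Re w <= 0)%R).
Proof.
  unfold cut_plane. assert (H0 := Cmod_ge_0 w). assert (H := Cmod_sqr w).
  split.
  - intros Hw [E Hle]. rewrite E in H. nra.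
  - intros Hn.
    destruct (Rlt_dec 0 (Re w)) as [Hr|Hr]; [lra|].
    assert (Im w <> 0%R) by (intros E; apply Hn; split; lra).
    assert (0 < Im w * Im w)%R by (apply Rlt_0_sqr; assumption).
    nra.
Qed.

Lemma cut_plane_neq_0 w : cut_plane w -> w <> 0.
Proof.
  unfold cut_plane. intros H E. rewrite E, Cmod_0 in H. simpl in H. lra.
Qed.

Lemma cut_plane_inv w : cut_plane w -> cut_plane (/ w).
Proof.
  intros H. assert (Hw := cut_plane_neq_0 w H).
  assert (Hm : (0 < Cmod w)%R) by now apply Cmod_gt_0.
  unfold cut_plane in *. rewrite Cmod_inv, Re_Cinv by exact Hw.
  replace (/ Cmod w + Re w / (Cmod w * Cmod w))%R
    with ((Cmod w + Re w) / (Cmod w * Cmod w))%R by (field; lra).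
  apply Rdiv_lt_0_compat; [exact H | nra].
Qed.

Lemma cut_plane_open w k :
  (Cmod k < (Cmod w + Re w) / 2)%R -> cut_plane (w - k).
Proof.
  intros H. unfold cut_plane.
  assert (H1 : (Cmod w <= Cmod (w - k) + Cmod k)%R).
  { replace w with ((w - k) + k) at 1 by ring. apply Cmod_triangle. }
  assert (H2 : (Rabs (Re k) <= Cmod k)%R)
    by (eapply Rle_trans; [apply Rmax_l | apply Rmax_Cmod]).
  assert (H3 := Rle_abs (Re k)).
  replace (Re (w - k)) with (Re w - Re k)%R by (unfold Re; simpl; ring).
  lra.
Qed.

(* The half-angle formula for the argument, smooth across the positive real axis. *)
Lemma Carg_atan w : cut_plane w ->
  Carg w = (2 * atan (Im w / (Cmod w + Re w)))%R.
Proof.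
  intros Hw. assert (H0 := cut_plane_neq_0 w Hw).
  assert (Hm : (0 < Cmod w)%R) by now apply Cmod_gt_0.
  assert (HS := Cmod_sqr w). unfold cut_plane in Hw.
  set (s := (Im w / (Cmod w + Re w))%R). set (th := atan s).
  assert (Hth : (- PI / 2 < th < PI / 2)%R) by apply atan_bound.
  assert (Hc : (0 < cos th)%R) by (apply cos_gt_0; lra).
  (* With s = tan th, cos(2 th) = (1 - s^2)/(1 + s^2), and s^2 = (|w| - Re w)/(|w| + Re w). *)
  assert (Hcos : cos (2 * th) = (Re w / Cmod w)%R).
  { assert (Ht : sin th = (s * cos th)%R).
    { assert (E : tan th = s) by apply tan_atan.
      rewrite <- E. unfold tan. field. lra. }
    assert (Hsc := sin2_cos2 th). unfold Rsqr in Hsc. rewrite Ht in Hsc.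
    rewrite cos_2a, Ht.
    assert (E : (cos th * cos th = / (1 + s * s))%R).
    { field_simplify_eq; nra. }
    replace (cos th * cos th - s * cos th * (s * cos th))%R
      with ((1 - s * s) * (cos th * cos th))%R by ring.
    rewrite E. unfold s.
    assert (Hd : (Im w * Im w = (Cmod w - Re w) * (Cmod w + Re w))%R) by nra.
    assert (E1 : (Im w / (Cmod w + Re w) * (Im w / (Cmod w + Re w)) =
      (Cmod w - Re w) / (Cmod w + Re w))%R).
    { field_simplify_eq; [|lra]. nra. }
    rewrite E1. field. split; lra. }
  unfold Carg. rewrite <- Hcos. destruct (Rle_dec 0 (Im w)) as [Hi|Hi].
  - assert (0 <= th)%R.
    { unfold th. destruct (Req_dec s 0) as [E|E].
      - rewrite E, atan_0. lra.
      - left. rewrite <- atan_0. apply atan_increasing.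
        assert (0 <= s)%R by (apply Rdiv_le_0_compat; lra). lra. }
    apply acos_cos. lra.
  - assert (th < 0)%R.
    { unfold th. rewrite <- atan_0. apply atan_increasing.
      unfold s. apply Rmult_lt_reg_r with (Cmod w + Re w)%R; [lra|].
      field_simplify; lra. }
    rewrite <- cos_neg, acos_cos; lra.
Qed.

Lemma Clog_atan w : cut_plane w ->
  Clog w = (ln (Cmod w), (2 * atan (Im w / (Cmod w + Re w)))%R).
Proof. intros H. unfold Clog. now rewrite Carg_atan. Qed.

(** Inversion changes the sign of the half-angle quotient Im w / (|w| + Re w), and atan is odd; no
    multiple of 2 PI i can enter. *)
Lemma Clog_inv w : cut_plane w -> Clog (/ w) = - Clog w.
Proof.
  intros H. assert (Hw := cut_plane_neq_0 w H).
  assert (Hm : (0 < Cmod w)%R) by now apply Cmod_gt_0.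
  rewrite !Clog_atan by (try apply cut_plane_inv; exact H).
  unfold Copp; cbn [fst snd]. f_equal.
  - rewrite Cmod_inv by exact Hw. now apply ln_Rinv.
  - rewrite Cmod_inv, Re_Cinv, Im_Cinv by exact Hw.
    unfold cut_plane in H.
    replace (- Im w / (Cmod w * Cmod w) / (/ Cmod w + Re w / (Cmod w * Cmod w)))%R
      with (- (Im w / (Cmod w + Re w)))%R.
    + rewrite atan_opp. ring.
    + field. repeat split; try lra.
Qed.

(** * Derivatives of complex functions of a real parameter *)

Definition is_derive_C (f : R -> C) (t : R) (l : C) : Prop :=
  is_derive (fun s => fst (f s)) t (fst l) /\
  is_derive (fun s => snd (f s)) t (snd l).

Lemma is_derive_C_mult f g t lf lg :
  is_derive_C f t lf -> is_derive_C g t lg ->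
  is_derive_C (fun s => f s * g s) t (lf * g t + f t * lg).
Proof.
  intros [Hf1 Hf2] [Hg1 Hg2]. split; simpl.
  - apply is_derive_ext with
      (fun s => minus (mult (fst (f s)) (fst (g s))) (mult (snd (f s)) (snd (g s))));
      [reflexivity|].
    replace (fst lf * fst (g t) - snd lf * snd (g t) +
      (fst (f t) * fst lg - snd (f t) * snd lg))%R with
      (minus (plus (mult (fst lf) (fst (g t))) (mult (fst (f t)) (fst lg)))
        (plus (mult (snd lf) (snd (g t))) (mult (snd (f t)) (snd lg))))
      by (unfold minus, plus, opp, mult; simpl; ring).
    apply (is_derive_minus (K := R_AbsRing) (V := R_NormedModule)).
    + apply (is_derive_mult (K := R_AbsRing)); auto. exact Rmult_comm.
    + apply (is_derive_mult (K := R_AbsRing)); auto. exact Rmult_comm.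
  - apply is_derive_ext with
      (fun s => plus (mult (fst (f s)) (snd (g s))) (mult (snd (f s)) (fst (g s))));
      [reflexivity|].
    replace (fst lf * snd (g t) + snd lf * fst (g t) +
      (fst (f t) * snd lg + snd (f t) * fst lg))%R with
      (plus (plus (mult (fst lf) (snd (g t))) (mult (fst (f t)) (snd lg)))
        (plus (mult (snd lf) (fst (g t))) (mult (snd (f t)) (fst lg))))
      by (unfold minus, plus, opp, mult; simpl; ring).
    apply (is_derive_plus (K := R_AbsRing) (V := R_NormedModule)).
    + apply (is_derive_mult (K := R_AbsRing)); auto. exact Rmult_comm.
    + apply (is_derive_mult (K := R_AbsRing)); auto. exact Rmult_comm.
Qed.

Lemma is_derive_C_const z t : is_derive_C (fun _ => z) t 0.
Proof. split; apply @is_derive_const. Qed.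

Lemma is_derive_exp_cos_sin (g h : R -> R) t lg lh :
  is_derive g t lg -> is_derive h t lh ->
  is_derive_C (fun s => ((exp (g s) * cos (h s))%R, (exp (g s) * sin (h s))%R)) t
    ((lg, lh) * ((exp (g t) * cos (h t))%R, (exp (g t) * sin (h t))%R)).
Proof.
  intros Hg Hh.
  split; cbn [fst snd Cmult].
  - auto_derive; [split; [exists lg|split; [exists lh|]]; auto|].
    replace (Derive _ t) with lg by (symmetry; exact (is_derive_unique g t lg Hg)).
    replace (Derive _ t) with lh by (symmetry; exact (is_derive_unique h t lh Hh)).
    ring.
  - auto_derive; [split; [exists lg|split; [exists lh|]]; auto|].
    replace (Derive _ t) with lg by (symmetry; exact (is_derive_unique g t lg Hg)).
    replace (Derive _ t) with lh by (symmetry; exact (is_derive_unique h t lh Hh)).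
    ring.
Qed.

Lemma is_derive_C_exp f t l :
  is_derive_C f t l -> is_derive_C (fun s => Cexp (f s)) t (l * Cexp (f t)).
Proof.
  intros [H1 H2]. destruct l as [l1 l2].
  exact (is_derive_exp_cos_sin _ _ t l1 l2 H1 H2).
Qed.

Lemma is_derive_C_zero_eq f :
  (forall t, (0 <= t <= 1)%R -> is_derive_C f t 0) -> f 0%R = f 1%R.
Proof.
  intros H.
  assert (H1 : fst (f 0%R) = fst (f 1%R)).
  { apply (eq_is_derive (V := R_NormedModule) (fun s => fst (f s))); [|lra].
    intros t Ht. exact (proj1 (H t Ht)). }
  assert (H2 : snd (f 0%R) = snd (f 1%R)).
  { apply (eq_is_derive (V := R_NormedModule) (fun s => snd (f s))); [|lra].
    intros t Ht. exact (proj2 (H t Ht)). }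
  destruct (f 0%R), (f 1%R). simpl in *. congruence.
Qed.

(** Stated for the half-angle expression rather than for [Clog], with which it is only known to
    agree on the cut plane; thus no neighbourhood of t has to be discussed. *)
Lemma is_derive_Clog_line (w k : C) t : cut_plane (w - RtoC t * k) ->
  is_derive_C (fun s => (ln (Cmod (w - RtoC s * k)),
     (2 * atan (Im (w - RtoC s * k) /
       (Cmod (w - RtoC s * k) + Re (w - RtoC s * k))))%R)) t
   (- k / (w - RtoC t * k)).
Proof.
  intros H. assert (H0 := cut_plane_neq_0 _ H).
  assert (Hm := proj1 (Cmod_gt_0 _) H0).
  assert (HS := Cmod_sqr (w - RtoC t * k)).
  unfold cut_plane in H.
  destruct w as [x y], k as [u v].
  assert (Hx : forall s, (x, y) - RtoC s * (u, v) = ((x - s * u)%R, (y - s * v)%R))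
    by (intros s; unfold RtoC, Cminus, Cplus, Copp, Cmult; simpl; f_equal; ring).
  rewrite Hx in *.
  set (X := (x - t * u)%R) in *. set (Y := (y - t * v)%R) in *.
  change (Re (X, Y)) with X in *. change (Im (X, Y)) with Y in *.
  set (rho := Cmod (X, Y)) in *.
  assert (Hpos : (0 < X * X + Y * Y)%R) by (rewrite <- HS; nra).
  assert (Hrho : rho = sqrt (X * X + Y * Y)).
  { unfold rho, Cmod. f_equal. simpl. ring. }
  split.
  - apply is_derive_ext with
      (fun s => ln (sqrt ((x - s * u) * (x - s * u) + (y - s * v) * (y - s * v))));
      [intros s; rewrite Hx; unfold Cmod; simpl; do 2 f_equal; ring|].
    simpl. auto_derive.
    + split; [exact Hpos|]. split; [|exact I]. now apply sqrt_lt_R0.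
    + change (x + - (t * u))%R with X. change (y + - (t * v))%R with Y.
      rewrite <- Hrho, !Rmult_1_r, <- HS. field. lra.
  - apply is_derive_ext with
      (fun s => 2 * atan ((y - s * v) / (sqrt ((x - s * u) * (x - s * u) + (y - s * v) * (y - s * v)) + (x - s * u))))%R;
      [intros s; rewrite Hx; unfold Cmod; simpl; rewrite !Rmult_1_r; reflexivity|].
    simpl. auto_derive;
      change (x + - (t * u))%R with X; change (y + - (t * v))%R with Y;
      rewrite <- Hrho.
    + repeat split; lra.
    + rewrite !Rmult_1_r, <- HS, !Rmult_1_l.
      assert (HY : (Y * Y = rho * rho - X * X)%R) by lra.
      (* Since Y^2 = rho^2 - X^2, the denominator in the derivative of atan becomes linear in
         rho. *)
      replace (1 + Y * / (rho + X) * (Y * / (rho + X)))%R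
        with (2 * rho / (rho + X))%R.
      2:{ transitivity (1 + Y * Y * / ((rho + X) * (rho + X)))%R;
          [rewrite HY; field; lra | field; lra]. }
      field_simplify_eq; [|lra].
      replace (Y ^ 2)%R with (rho * rho - X * X)%R by (rewrite <- HY; ring).
      ring.
Qed.

(** * The binomial series *)

(** The coefficient of u^n in (1 - u)^(-a). *)
Definition binom_coef (a : C) (n : nat) : C := poch a n / NtoC (fact n).

Lemma binom_coef_S a n :
  (NtoC n + 1) * binom_coef a (S n) = (a + NtoC n) * binom_coef a n.
Proof.
  unfold binom_coef. rewrite poch_S, NtoC_fact_S. field.
  split; [apply NtoC_fact_neq_0|]. rewrite <- NtoC_S. apply NtoC_neq_0; lia.
Qed.

Lemma binom_coef_0 a : binom_coef a 0 = 1.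
Proof. unfold binom_coef. simpl. change (NtoC 1) with (RtoC 1). field. Qed.

Lemma binom_coef_pascal a n :
  binom_coef (a + 1) (S n) = binom_coef a (S n) + binom_coef (a + 1) n.
Proof.
  unfold binom_coef. rewrite (poch_S (a + 1)), (poch_S_left a), NtoC_fact_S. field.
  split; [apply NtoC_fact_neq_0|]. rewrite <- NtoC_S. apply NtoC_neq_0; lia.
Qed.

Lemma Cmod_NtoC n : Cmod (NtoC n) = INR n.
Proof. unfold NtoC. rewrite Cmod_R. apply Rabs_pos_eq, pos_INR. Qed.

(** The coefficient is binom(N+n-1, n) for N > 0; Pascal's rule in a double induction yields the
    power of 2. *)
Lemma Cmod_binom_coef_nat N n : (Cmod (binom_coef (NtoC N) n) <= 2 ^ (N + n))%R.
Proof.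
  revert n. induction N as [|N IHN]; intros n.
  - destruct n as [|n].
    + rewrite binom_coef_0, Cmod_1. simpl. lra.
    + unfold binom_coef. rewrite poch_S_left.
      replace (NtoC 0 * poch (NtoC 0 + 1) n / NtoC (fact (S n))) with (RtoC 0)
        by (change (NtoC 0) with (RtoC 0); unfold Cdiv; ring).
      rewrite Cmod_0. apply pow_le. lra.
  - induction n as [|n IHn].
    + rewrite binom_coef_0, Cmod_1. apply pow_R1_Rle. lra.
    + rewrite NtoC_S, binom_coef_pascal, <- NtoC_S.
      eapply Rle_trans; [apply Cmod_triangle|].
      specialize (IHN (S n)).
      replace (N + S n)%nat with (S N + n)%nat in IHN by lia.
      replace (S N + S n)%nat with (S (S N + n))%nat by lia.
      rewrite <- tech_pow_Rmult. lra.
Qed.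

(** Factor by factor, |z + i| <= N + i, so the coefficient for the integer N is a majorant. *)
Lemma Cmod_binom_coef_le z N n :
  (Cmod z <= INR N)%R -> (Cmod (binom_coef z n) <= 2 ^ (N + n))%R.
Proof.
  intros Hz. eapply Rle_trans; [|apply Cmod_binom_coef_nat].
  unfold binom_coef. rewrite !Cmod_div by apply NtoC_fact_neq_0.
  apply Rmult_le_compat_r.
  { left. apply Rinv_0_lt_compat. rewrite Cmod_NtoC. apply INR_fact_lt_0. }
  induction n as [|n IH]; [simpl; lra|].
  rewrite !poch_S, !Cmod_mult. apply Rmult_le_compat; try apply Cmod_ge_0; auto.
  rewrite <- NtoC_plus, Cmod_NtoC, plus_INR.
  eapply Rle_trans; [apply Cmod_triangle|]. rewrite Cmod_NtoC. lra.
Qed.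

(** M depends on a alone: this uniformity in n is what makes the double series in [pfaff_local]
    dominated. *)
Lemma Cmod_binom_coef_shift_le a : exists M, forall n l,
  (Cmod (binom_coef (a + NtoC n) l) <= 2 ^ M * 2 ^ n * 2 ^ l)%R.
Proof.
  destruct (INR_unbounded (Cmod a)) as [M HM]. exists M. intros n l.
  rewrite <- !pow_add. apply Cmod_binom_coef_le.
  rewrite plus_INR. eapply Rle_trans; [apply Cmod_triangle|].
  rewrite Cmod_NtoC. lra.
Qed.

(** The bound 2^n on the coefficients against 8^(-n) leaves 4^(-n). As a power series in t the terms
    then have radius greater than 1, so the closed interval [0,1] lies inside the region of
    differentiability. *)
Lemma binom_term_bound a u : (Cmod u <= / 8)%R ->
  exists A, (0 <= A)%R /\ forall n, (Cmod (binom_coef a n * u ^ n) <= A * (/ 4) ^ n)%R.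
Proof.
  intros Hu. destruct (Cmod_binom_coef_shift_le a) as [M HM].
  exists (2 ^ M)%R. split; [apply pow_le; lra|]. intros n.
  specialize (HM 0%nat n). change (NtoC 0) with (RtoC 0) in HM.
  rewrite Cplus_0_r, pow_O, Rmult_1_r in HM.
  rewrite Cmod_mult, Cmod_pow.
  replace (2 ^ M * (/ 4) ^ n)%R with (2 ^ M * 2 ^ n * (/ 8) ^ n)%R.
  - apply Rmult_le_compat; [apply Cmod_ge_0|apply pow_le, Cmod_ge_0|exact HM|].
    apply pow_incr. split; [apply Cmod_ge_0|exact Hu].
  - rewrite Rmult_assoc, <- Rpow_mult_distr. do 2 f_equal. lra.
Qed.

Lemma binom_series_ex a u : (Cmod u <= / 8)%R ->
  exists l, Cser (fun n => binom_coef a n * u ^ n) l.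
Proof.
  intros Hu. destruct (binom_term_bound a u Hu) as [A [HA H]].
  apply Cser_geom_ex with A. intros n. eapply Rle_trans; [apply H|].
  apply Rmult_le_compat_l; [exact HA|]. apply pow_incr. lra.
Qed.

(** Pascal's rule as (1 - u) (1 - u)^(-a-1) = (1 - u)^(-a); it moves the exponent by integers
    without any law for complex powers. *)
Lemma binom_series_shift a u l l' :
  Cser (fun n => binom_coef a n * u ^ n) l ->
  Cser (fun n => binom_coef (a + 1) n * u ^ n) l' ->
  (1 - u) * l' = l.
Proof.
  intros H H'. apply (Cser_unique (fun n => binom_coef a n * u ^ n)); [|exact H].
  assert (H1 := H'). apply Cser_shift in H1.
  apply Cser_shift. rewrite !binom_coef_0 in *. simpl in *.
  replace ((1 - u) * l' - 1 * 1) with (l' - 1 * 1 - u * l') by ring.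
  apply Cser_ext with (2 := Cser_minus _ _ _ _ H1 (Cser_scal u _ _ H')).
  intros n. simpl. rewrite binom_coef_pascal. ring.
Qed.

Lemma CV_radius_gt_1 (c : nat -> R) A :
  (forall n, Rabs (c n) <= A * (/ 4) ^ n)%R -> Rbar_lt 1 (CV_radius c).
Proof.
  intros H. apply Rbar_lt_le_trans with (Finite 2); [simpl; lra|].
  apply CV_radius_bounded. exists A. intros n.
  rewrite Rabs_mult, <- RPow_abs, (Rabs_pos_eq 2) by lra.
  assert (HA : (0 <= A)%R).
  { specialize (H 0%nat). simpl in H. generalize (Rabs_pos (c 0%nat)). lra. }
  apply Rle_trans with (A * (/ 4) ^ n * 2 ^ n)%R.
  - apply Rmult_le_compat_r; [apply pow_le; lra | apply H].
  - rewrite Rmult_assoc, <- Rpow_mult_distr.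
    rewrite <- (Rmult_1_r A) at 2. apply Rmult_le_compat_l; [exact HA|].
    rewrite <- (pow1 n). apply pow_incr. lra.
Qed.

(** Complex coefficients but a real variable: split into components, the series falls under the
    theory of real power series and their derivatives. *)
Definition Cpser (d : nat -> C) (t : R) : C :=
  (PSeries (fun n => fst (d n)) t, PSeries (fun n => snd (d n)) t).

Definition Cps_derive (d : nat -> C) (n : nat) : C := (NtoC n + 1) * d (S n).

Lemma fst_Cps_derive d n : fst (Cps_derive d n) = PS_derive (fun n => fst (d n)) n.
Proof.
  unfold Cps_derive, PS_derive. rewrite <- NtoC_S. unfold NtoC, RtoC. cbn [fst snd Cmult]. ring.
Qed.

Lemma snd_Cps_derive d n : snd (Cps_derive d n) = PS_derive (fun n => snd (d n)) n.
Proof.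
  unfold Cps_derive, PS_derive. rewrite <- NtoC_S. unfold NtoC, RtoC. cbn [fst snd Cmult]. ring.
Qed.

Lemma fst_CV_radius_gt_1 (d : nat -> C) (A : R) :
  (forall n, (Cmod (d n) <= A * (/ 4) ^ n)%R) ->
  Rbar_lt 1 (CV_radius (fun n => fst (d n))).
Proof.
  intros Hd. apply CV_radius_gt_1 with A. intros n. eapply Rle_trans; [|apply Hd].
  eapply Rle_trans; [|apply Rmax_Cmod]. apply Rmax_l.
Qed.

Lemma snd_CV_radius_gt_1 (d : nat -> C) (A : R) :
  (forall n, (Cmod (d n) <= A * (/ 4) ^ n)%R) ->
  Rbar_lt 1 (CV_radius (fun n => snd (d n))).
Proof.
  intros Hd. apply CV_radius_gt_1 with A. intros n. eapply Rle_trans; [|apply Hd].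
  eapply Rle_trans; [|apply Rmax_Cmod]. apply Rmax_r.
Qed.

Lemma Rabs_lt_radius t c : (0 <= t <= 1)%R -> Rbar_lt 1 (CV_radius c) ->
  Rbar_lt (Rabs t) (CV_radius c).
Proof.
  intros Ht. apply Rbar_le_lt_trans. simpl. rewrite Rabs_pos_eq; lra.
Qed.

Lemma is_series_PSeries (c : nat -> R) t :
  Rbar_lt (Rabs t) (CV_radius c) -> is_series (fun n => t ^ n * c n)%R (PSeries c t).
Proof.
  intros H. apply is_series_ext with (fun n => scal (pow_n t n) (c n)).
  - intros n. rewrite pow_n_pow. reflexivity.
  - apply (PSeries_correct c t). now apply CV_radius_inside.
Qed.

Lemma Cser_Cpser (d : nat -> C) (A : R) :
  (forall n, (Cmod (d n) <= A * (/ 4) ^ n)%R) ->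
  forall t, (0 <= t <= 1)%R -> Cser (fun n => RtoC t ^ n * d n) (Cpser d t).
Proof.
  intros Hd t Ht. apply Cser_components. split.
  - apply is_series_ext with (fun n => t ^ n * fst (d n))%R.
    + intros n. rewrite <- RtoC_pow. simpl. ring.
    + apply is_series_PSeries, Rabs_lt_radius; [exact Ht | exact (fst_CV_radius_gt_1 d A Hd)].
  - apply is_series_ext with (fun n => t ^ n * snd (d n))%R.
    + intros n. rewrite <- RtoC_pow. simpl. ring.
    + apply is_series_PSeries, Rabs_lt_radius; [exact Ht | exact (snd_CV_radius_gt_1 d A Hd)].
Qed.

Lemma Cser_Cps_derive (d : nat -> C) (A : R) :
  (forall n, (Cmod (d n) <= A * (/ 4) ^ n)%R) ->
  forall t, (0 <= t <= 1)%R ->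
  Cser (fun n => RtoC t ^ n * Cps_derive d n) (Cpser (Cps_derive d) t).
Proof.
  intros Hd t Ht. apply Cser_components. split.
  - apply is_series_ext with (fun n => t ^ n * fst (Cps_derive d n))%R.
    + intros n. rewrite <- RtoC_pow. simpl. ring.
    + apply is_series_PSeries.
      rewrite (CV_radius_ext _ _ (fst_Cps_derive d)), CV_radius_derive.
      apply Rabs_lt_radius; [exact Ht | exact (fst_CV_radius_gt_1 d A Hd)].
  - apply is_series_ext with (fun n => t ^ n * snd (Cps_derive d n))%R.
    + intros n. rewrite <- RtoC_pow. simpl. ring.
    + apply is_series_PSeries.
      rewrite (CV_radius_ext _ _ (snd_Cps_derive d)), CV_radius_derive.
      apply Rabs_lt_radius; [exact Ht | exact (snd_CV_radius_gt_1 d A Hd)].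
Qed.

Lemma is_derive_Cpser (d : nat -> C) (A : R) :
  (forall n, (Cmod (d n) <= A * (/ 4) ^ n)%R) ->
  forall t, (0 <= t <= 1)%R ->
  is_derive_C (Cpser d) t (Cpser (Cps_derive d) t).
Proof.
  intros Hd t Ht. split; cbn [fst snd Cpser].
  - rewrite (PSeries_ext _ _ t (fst_Cps_derive d)).
    apply is_derive_PSeries, Rabs_lt_radius; [exact Ht | exact (fst_CV_radius_gt_1 d A Hd)].
  - rewrite (PSeries_ext _ _ t (snd_Cps_derive d)).
    apply is_derive_PSeries, Rabs_lt_radius; [exact Ht | exact (snd_CV_radius_gt_1 d A Hd)].
Qed.

Lemma Cexp_opp_r z : Cexp z * Cexp (- z) = 1.
Proof.
  unfold Cexp, Cmult, RtoC, Re, Im; simpl.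
  rewrite cos_neg, sin_neg, exp_Ropp.
  assert (H := exp_pos (fst z)). assert (H2 := sin2_cos2 (snd z)). unfold Rsqr in H2.
  f_equal; field_simplify; try lra.
Qed.

(* Along the segment t |-> v - t k, the product of (v - t k)^a with the binomial
   series of (1 - t k / v)^(-a) has zero derivative. *)
Lemma binom_series_power a v k l :
  (forall t, (0 <= t <= 1)%R -> cut_plane (v - RtoC t * k)) ->
  (Cmod (k / v) <= / 8)%R ->
  Cser (fun n => binom_coef a n * (k / v) ^ n) l ->
  Cexp (- a * Clog (v - k)) = Cexp (- a * Clog v) * l.
Proof.
  intros Hcut Hk Hl. set (u := k / v) in *.
  assert (Hv : v <> 0).
  { apply cut_plane_neq_0. replace v with (v - RtoC 0 * k) by ring. apply Hcut. lra. }
  set (d := fun n => binom_coef a n * u ^ n).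
  destruct (binom_term_bound a u Hk) as [A [HA Hd]]. fold d in Hd.
  change (forall n, (Cmod (d n) <= A * (/ 4) ^ n)%R) in Hd.
  set (L := fun s => (ln (Cmod (v - RtoC s * k)),
     (2 * atan (Im (v - RtoC s * k) /
       (Cmod (v - RtoC s * k) + Re (v - RtoC s * k))))%R)).
  assert (HL : forall t, (0 <= t <= 1)%R -> L t = Clog (v - RtoC t * k)).
  { intros t Ht. symmetry. apply Clog_atan, Hcut, Ht. }
  (* The differential equation (1 - t u) B' = a u B of the binomial series, multiplied by v; it is
     the recurrence [binom_coef_S] summed over n. *)
  assert (Hode : forall t, (0 <= t <= 1)%R ->
    (v - RtoC t * k) * Cpser (Cps_derive d) t = a * k * Cpser d t).
  { intros t Ht.
    assert (HB := Cser_Cpser d A Hd t Ht).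
    assert (HD := Cser_Cps_derive d A Hd t Ht).
    set (B := Cpser d t) in *. set (B' := Cpser (Cps_derive d) t) in *.
    assert (Hn : Cser (fun n => NtoC n * (RtoC t ^ n * d n)) (RtoC t * B')).
    { apply Cser_shift. change (NtoC 0) with (RtoC 0).
      replace (RtoC t * B' - 0 * (RtoC t ^ 0 * d 0%nat)) with (RtoC t * B') by ring.
      apply Cser_ext with (2 := Cser_scal (RtoC t) _ _ HD).
      intros n. unfold Cps_derive. rewrite NtoC_S, Cpow_S. ring. }
    assert (E : B' = u * (a * B + RtoC t * B')).
    { apply (Cser_unique _ _ _ HD).
      apply Cser_ext with (2 := Cser_scal u _ _ (Cser_plus _ _ _ _ (Cser_scal a _ _ HB) Hn)).
      intros n. unfold Cps_derive, d. rewrite Cpow_S.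
      replace ((NtoC n + 1) * (binom_coef a (S n) * (u * u ^ n)))
        with ((NtoC n + 1) * binom_coef a (S n) * (u * u ^ n)) by ring.
      rewrite binom_coef_S. ring. }
    assert (E2 : v * B' = k * (a * B + RtoC t * B')).
    { rewrite E at 1. unfold u. field. exact Hv. }
    replace ((v - RtoC t * k) * B') with (v * B' - RtoC t * k * B') by ring.
    rewrite E2. ring. }
  assert (Hconst : Cexp (a * L 0%R) * Cpser d 0 = Cexp (a * L 1%R) * Cpser d 1).
  { apply (is_derive_C_zero_eq (fun t => Cexp (a * L t) * Cpser d t)).
    intros t Ht.
    assert (H1 := is_derive_C_mult _ _ t _ _ (is_derive_C_const a t)
      (is_derive_Clog_line v k t (Hcut t Ht))).
    fold (L t) in H1.
    change (is_derive_C (fun s => a * L s) t (0 * L t + a * (- k / (v - RtoC t * k)))) in H1.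
    apply is_derive_C_exp in H1.
    assert (H2 := is_derive_C_mult _ _ t _ _ H1 (is_derive_Cpser d A Hd t Ht)).
    cbv beta in H2. match type of H2 with is_derive_C _ _ ?z => replace z with (RtoC 0) in H2; [exact H2|] end.
    assert (H0 := cut_plane_neq_0 _ (Hcut t Ht)).
    replace (Cpser (Cps_derive d) t) with (a * k * Cpser d t / (v - RtoC t * k))
      by (rewrite <- (Hode t Ht); field; exact H0).
    field. exact H0. }
  assert (B0 : Cpser d 0 = 1).
  { unfold Cpser. rewrite !PSeries_0. unfold d. rewrite binom_coef_0. simpl.
    unfold RtoC. f_equal; ring. }
  assert (B1 : Cpser d 1 = l).
  { apply (Cser_unique d); [|exact Hl].
    apply Cser_ext with (2 := Cser_Cpser d A Hd 1 ltac:(lra)).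
    intros n. rewrite Cpow_1_l. ring. }
  rewrite B0, B1, !HL in Hconst by lra.
  replace (v - RtoC 0 * k) with v in Hconst by ring.
  replace (v - RtoC 1 * k) with (v - k) in Hconst by ring.
  (* Equality at the two ends has the exponents +a; multiplying by both inverse exponentials gives
     the claim with -a. *)
  assert (P1 := Cexp_opp_r (a * Clog v)).
  assert (P2 := Cexp_opp_r (a * Clog (v - k))).
  replace (- a * Clog (v - k)) with (- (a * Clog (v - k))) by ring.
  replace (- a * Clog v) with (- (a * Clog v)) by ring.
  set (X := Cexp (a * Clog v)) in *. set (X' := Cexp (- (a * Clog v))) in *.
  set (Y := Cexp (a * Clog (v - k))) in *. set (Y' := Cexp (- (a * Clog (v - k)))) in *.
  transitivity ((X * 1) * X' * Y'); [replace (X * 1 * X') with (X * X') by ring; rewrite P1; ring|].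
  rewrite Hconst. transitivity ((Y * Y') * (X' * l)); [ring | rewrite P2; ring].
Qed.

(** * Pfaff's transformation of a power series *)

(** The coefficient of k^j in (1 - x)^a F(x) for y = y0 + k, v = 1 - y0, where [c] expands F at x0.
    With u = k/v the n-th term is v^(-a) c_n (-k/v^2)^n (1 - u)^(-a-n); its part of order j - n in u
    carries v to the power -(j - n) - 2n = -(j + n). *)
Definition pfaff_coef (a v : C) (c : nat -> C) (j : nat) : C :=
  Cexp (- a * Clog v) *
  Csum (fun n => c n * (- (1)) ^ n * binom_coef (a + NtoC n) (j - n) *
    (/ v) ^ (j + n)) j.

Lemma Cpower_inv v a : cut_plane v -> Cpower (/ v) a = Cexp (- a * Clog v).
Proof. intros H. unfold Cpower. rewrite Clog_inv by exact H. f_equal. ring. Qed.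

(* With v = 1 - y0, x = y / (y - 1) and y = y0 + k one has 1 - x = 1 / (v - k)
   and x - x0 = - k / (v (v - k)); the n-th power of the latter times (1 - x)^a
   is expanded by the binomial series with exponent - a - n. *)
Lemma pfaff_local a v F c (d : R) :
  cut_plane v -> (0 < d)%R ->
  (forall h, (Cmod h < d)%R -> Cser (fun n => h ^ n * c n) (F (1 - / v + h))) ->
  exists delta : posreal, forall k, (Cmod k < delta)%R ->
    Cser (fun j => k ^ j * pfaff_coef a v c j)
      (Cpower (/ (v - k)) a * F (1 - / (v - k))).
Proof.
  intros Hv Hd HF.
  assert (v0 := cut_plane_neq_0 v Hv).
  assert (Hm : (0 < Cmod v)%R) by now apply Cmod_gt_0.
  set (mv := Cmod v) in *.
  (* The first bound keeps the segment from v to v - k in the cut plane, the second gives |k/v| <=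
     1/8, the third gives 2|k|/|v|^2 <= d/4, used both for |h| < d and for the domination of the
     double series. *)
  assert (Hdelta : (0 < Rmin ((mv + Re v) / 2) (Rmin (mv / 8) (d * (mv * mv) / 8)))%R).
  { unfold cut_plane in Hv. fold mv in Hv.
    assert (0 < d * (mv * mv))%R by (apply Rmult_lt_0_compat; [|apply Rmult_lt_0_compat]; lra).
    repeat apply Rmin_glb_lt; lra. }
  exists (mkposreal _ Hdelta). simpl. intros k Hk.
  assert (Hk1 : (Cmod k < (mv + Re v) / 2)%R)
    by (eapply Rlt_le_trans; [exact Hk | apply Rmin_l]).
  assert (Hk' := Rlt_le_trans _ _ _ Hk (Rmin_r _ _)).
  assert (Hk2 := Rlt_le_trans _ _ _ Hk' (Rmin_l _ _)).
  assert (Hk3 := Rlt_le_trans _ _ _ Hk' (Rmin_r _ _)).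
  assert (Hk0 := Cmod_ge_0 k). clear Hk Hk' Hdelta.
  assert (Hcut : forall t, (0 <= t <= 1)%R -> cut_plane (v - RtoC t * k)).
  { intros t Ht. apply cut_plane_open. rewrite Cmod_mult, Cmod_R, Rabs_pos_eq by lra.
    fold mv. nra. }
  assert (Hvk : v - k <> 0).
  { apply cut_plane_neq_0. replace k with (RtoC 1 * k) by ring. apply Hcut. lra. }
  assert (Hu : (Cmod (k / v) <= / 8)%R).
  { rewrite Cmod_div by exact v0. fold mv.
    apply Rmult_le_reg_r with mv; [exact Hm|].
    unfold Rdiv. rewrite Rmult_assoc, Rinv_l by lra. lra. }
  set (u := k / v) in *.
  assert (H1u : 1 - u <> 0).
  { unfold u. replace (1 - k / v) with ((v - k) / v) by (field; exact v0).
    intros E. apply Hvk. replace (v - k) with ((v - k) / v * v) by (field; exact v0).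
    rewrite E. ring. }
  assert (Hex : forall n, exists l, Cser (fun i => binom_coef (a + NtoC n) i * u ^ i) l)
    by (intros n; now apply binom_series_ex).
  destruct (Hex 0%nat) as [l Hl].
  change (NtoC 0) with (RtoC 0) in Hl. rewrite Cplus_0_r in Hl.
  (* All the binomial series are expressed through the single value l, which stands for (1 -
     u)^(-a). *)
  assert (Hln : forall n ln, Cser (fun i => binom_coef (a + NtoC n) i * u ^ i) ln ->
    ln = l / (1 - u) ^ n).
  { induction n as [|n IH]; intros ln Hn.
    - change (NtoC 0) with (RtoC 0) in Hn. rewrite Cplus_0_r in Hn.
      rewrite (Cser_unique _ _ _ Hn Hl). simpl. field.
    - destruct (Hex n) as [ln' Hn'].
      rewrite NtoC_S, Cplus_assoc in Hn.
      assert (E := binom_series_shift _ _ _ _ Hn' Hn).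
      rewrite (IH _ Hn') in E. rewrite Cpow_S.
      transitivity (((1 - u) * ln) / (1 - u)); [field; exact H1u|].
      rewrite E. field. split; [now apply Cpow_nz | exact H1u]. }
  set (h := - (k / (v * v)) / (1 - u)).
  assert (Hh : h = - k / (v * (v - k))).
  { unfold h, u. field. repeat split; try assumption. }
  assert (Hhd : (Cmod h < d)%R).
  { rewrite Hh, Cmod_div, Cmod_opp, Cmod_mult by (now apply Cmult_neq_0). fold mv.
    assert (Hge : (mv / 2 < Cmod (v - k))%R).
    { assert (mv <= Cmod (v - k) + Cmod k)%R
        by (unfold mv; replace v with ((v - k) + k) at 1 by ring; apply Cmod_triangle).
      lra. }
    apply Rmult_lt_reg_r with (mv * Cmod (v - k))%R; [nra|].
    unfold Rdiv. rewrite Rmult_assoc, Rinv_l, Rmult_1_r by nra.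
    apply Rlt_trans with (d * (mv * mv) / 8)%R; [exact Hk3|]. nra. }
  assert (HFh := HF h Hhd).
  replace (1 - / v + h) with (1 - / (v - k)) in HFh
    by (rewrite Hh; field; split; assumption).
  replace (Cpower (/ (v - k)) a) with (Cexp (- a * Clog v) * l).
  2:{ rewrite Cpower_inv by (replace k with (RtoC 1 * k) by ring; apply Hcut; lra).
      symmetry. now apply binom_series_power. }
  set (T := fun n i => c n * (- (1)) ^ n * binom_coef (a + NtoC n) i *
    (k ^ (n + i) * (/ v) ^ (n + i + n))).
  assert (HT : forall n i, T n i = c n * (- (k / (v * v))) ^ n * (binom_coef (a + NtoC n) i * u ^ i)).
  { intros n i. unfold T, u, Cdiv.
    replace (- (k * / (v * v))) with (- (1) * (k * (/ v * / v))) by (field; exact v0).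
    rewrite !Cpow_mult_l, !Cpow_add_r. ring. }
  destruct (Cmod_binom_coef_shift_le a) as [M HM].
  (* Convergence at h = d/2 gives a Cauchy estimate |c_n| (d/2)^n <= B. *)
  assert (Hd2 : (Cmod (RtoC (d / 2)) < d)%R) by (rewrite Cmod_R, Rabs_pos_eq; lra).
  destruct (Cser_terms_bounded _ _ (HF _ Hd2)) as [B [HB Hc]].
  (* The factors 2^n and 2^i from [HM] are absorbed by |k/v^2|^n and |u|^i; the Cauchy estimate
     absorbs (d/2)^n and leaves 2^(-n). *)
  assert (HTb : forall n i, (Cmod (T n i) <= B * 2 ^ M * (/ 2) ^ n * (/ 2) ^ i)%R).
  { intros n i. rewrite HT, !Cmod_mult, !Cmod_pow, Cmod_opp.
    assert (Hc' : (Cmod (c n) * Cmod (k / (v * v)) ^ n * 2 ^ n <= B * (/ 2) ^ n)%R).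
    { rewrite Rmult_assoc, <- Rpow_mult_distr.
      assert (Hq : (0 <= Cmod (k / (v * v)) * 2 <= d / 2 * / 2)%R).
      { rewrite Cmod_div, Cmod_mult by (now apply Cmult_neq_0). fold mv.
        assert (0 < mv * mv)%R by nra.
        split; [apply Rmult_le_pos; [apply Rdiv_le_0_compat|]; lra|].
        apply Rmult_le_reg_r with (mv * mv)%R; [assumption|].
        replace (Cmod k / (mv * mv) * 2 * (mv * mv))%R with (2 * Cmod k)%R
          by (field; lra). lra. }
      apply Rle_trans with (Cmod (c n) * (d / 2 * / 2) ^ n)%R.
      { apply Rmult_le_compat_l; [apply Cmod_ge_0|]. now apply pow_incr. }
      rewrite Rpow_mult_distr, <- Rmult_assoc.
      apply Rmult_le_compat_r; [apply pow_le; lra|].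
      specialize (Hc n). rewrite Cmod_mult, Cmod_pow, Cmod_R, Rabs_pos_eq in Hc by lra.
      lra. }
    assert (Hu' : (Cmod u ^ i * 2 ^ i <= (/ 2) ^ i)%R).
    { rewrite <- Rpow_mult_distr. apply pow_incr.
      generalize (Cmod_ge_0 u). lra. }
    specialize (HM n i).
    apply Rle_trans with
      (Cmod (c n) * Cmod (k / (v * v)) ^ n * (2 ^ M * 2 ^ n * 2 ^ i * Cmod u ^ i))%R.
    { apply Rmult_le_compat_l.
      - apply Rmult_le_pos; [apply Cmod_ge_0 | apply pow_le, Cmod_ge_0].
      - apply Rmult_le_compat_r; [apply pow_le, Cmod_ge_0 | exact HM]. }
    replace (Cmod (c n) * Cmod (k / (v * v)) ^ n * (2 ^ M * 2 ^ n * 2 ^ i * Cmod u ^ i))%R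
      with (2 ^ M * ((Cmod (c n) * Cmod (k / (v * v)) ^ n * 2 ^ n) * (Cmod u ^ i * 2 ^ i)))%R
      by ring.
    replace (B * 2 ^ M * (/ 2) ^ n * (/ 2) ^ i)%R
      with (2 ^ M * ((B * (/ 2) ^ n) * (/ 2) ^ i))%R by ring.
    apply Rmult_le_compat_l; [apply pow_le; lra|].
    apply Rmult_le_compat; [| |exact Hc'|exact Hu'].
    - repeat apply Rmult_le_pos; try apply pow_le; try apply Cmod_ge_0; lra.
    - apply Rmult_le_pos; apply pow_le; [apply Cmod_ge_0 | lra]. }
  assert (HS : Cser (fun j => Csum (fun n => T n (j - n)%nat) j) (l * F (1 - / (v - k)))).
  { apply triangle_sum with (fun n => B * 2 ^ M * (/ 2) ^ n)%R (fun n => 1 * (/ 2) ^ n)%R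
      (fun n => l * (h ^ n * c n)).
    - intros n. repeat apply Rmult_le_pos; try apply pow_le; lra.
    - intros n. apply Rmult_le_pos; try apply pow_le; lra.
    - intros n i. rewrite Rmult_1_l. apply HTb.
    - apply geom_half_bounded_ex.
    - apply geom_half_bounded_ex.
    - intros n. destruct (Hex n) as [ln Hn].
      replace (l * (h ^ n * c n)) with (c n * (- (k / (v * v))) ^ n * ln).
      + apply Cser_ext with (2 := Cser_scal (c n * (- (k / (v * v))) ^ n) _ _ Hn).
        intros i. now rewrite HT.
      + rewrite (Hln _ _ Hn). unfold h, Cdiv. rewrite (Cpow_mult_l (- (k * / (v * v)))).
        rewrite Cpow_inv by exact H1u. ring.
    - now apply Cser_scal. }
  replace (Cexp (- a * Clog v) * l * F (1 - / (v - k)))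
    with (Cexp (- a * Clog v) * (l * F (1 - / (v - k)))) by ring.
  apply Cser_ext with (2 := Cser_scal (Cexp (- a * Clog v)) _ _ HS).
  intros j. unfold pfaff_coef.
  replace (k ^ j * (Cexp (- a * Clog v) *
    Csum (fun n => c n * (- (1)) ^ n * binom_coef (a + NtoC n) (j - n) * (/ v) ^ (j + n)) j))
  with (Cexp (- a * Clog v) * (k ^ j *
    Csum (fun n => c n * (- (1)) ^ n * binom_coef (a + NtoC n) (j - n) * (/ v) ^ (j + n)) j))
    by ring.
  rewrite <- (Csum_scal (k ^ j)). f_equal. apply Csum_ext. intros n Hn. unfold T.
  replace (n + (j - n))%nat with j by lia. ring.
Qed.

(** * Analytic functions and the identity theorem *)

Lemma Cser_zero : Cser (fun _ => 0) 0.
Proof.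
  apply Cser_iff. apply is_lim_seq_ext with (fun _ => 0%R); [|apply is_lim_seq_const].
  intros n. induction n as [|n IH].
  - rewrite Csum_O. replace (0 - 0) with (RtoC 0) by ring. now rewrite Cmod_0.
  - rewrite Csum_S, Cplus_0_r. exact IH.
Qed.

Lemma analytic_const z z0 : analytic_at (fun _ => z) z0.
Proof.
  exists (fun n => match n with O => z | _ => 0 end), (mkposreal 1 Rlt_0_1).
  intros h _. apply is_pseries_Cser, Cser_shift. simpl.
  replace (z - 1 * z) with (RtoC 0) by ring.
  apply Cser_ext with (2 := Cser_zero). intros n. ring.
Qed.

Lemma analytic_plus f g z0 :
  analytic_at f z0 -> analytic_at g z0 -> analytic_at (fun z => f z + g z) z0.
Proof.
  intros [c [d Hf]] [c' [d' Hg]].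
  exists (fun n => c n + c' n), (mkposreal _ (Rmin_stable_in_posreal d d')).
  simpl. intros h Hh. apply is_pseries_Cser.
  assert (H1 := Hf h (Rlt_le_trans _ _ _ Hh (Rmin_l _ _))).
  assert (H2 := Hg h (Rlt_le_trans _ _ _ Hh (Rmin_r _ _))).
  apply (proj1 (is_pseries_Cser _ _ _)) in H1, H2.
  apply Cser_ext with (2 := Cser_plus _ _ _ _ H1 H2). intros n. ring.
Qed.

Lemma analytic_scal x f z0 : analytic_at f z0 -> analytic_at (fun z => x * f z) z0.
Proof.
  intros [c [d Hf]]. exists (fun n => x * c n), d. intros h Hh.
  apply is_pseries_Cser. specialize (Hf h Hh). apply (proj1 (is_pseries_Cser _ _ _)) in Hf.
  apply Cser_ext with (2 := Cser_scal x _ _ Hf). intros n. ring.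
Qed.

Lemma analytic_id_mult f z0 : analytic_at f z0 -> analytic_at (fun z => z * f z) z0.
Proof.
  intros [c [d Hf]].
  (* Multiplication by z0 + h: z0 scales the coefficients, h moves them up by one index. *)
  exists (fun n => z0 * c n + match n with O => 0 | S i => c i end), d.
  intros h Hh. apply is_pseries_Cser.
  specialize (Hf h Hh). apply (proj1 (is_pseries_Cser _ _ _)) in Hf.
  replace ((z0 + h) * f (z0 + h)) with (z0 * f (z0 + h) + h * f (z0 + h)) by ring.
  assert (H : Cser (fun n => h ^ n * match n with O => 0 | S i => c i end) (h * f (z0 + h))).
  { apply Cser_shift. simpl.
    replace (h * f (z0 + h) - 1 * 0) with (h * f (z0 + h)) by ring.
    apply Cser_ext with (2 := Cser_scal h _ _ Hf). intros n. ring. }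
  apply Cser_ext with (2 := Cser_plus _ _ _ _ (Cser_scal z0 _ _ Hf) H).
  intros n. ring.
Qed.

Lemma analytic_pow_mult n f z0 : analytic_at f z0 -> analytic_at (fun z => z ^ n * f z) z0.
Proof.
  intros Hf. induction n as [|n IH].
  - destruct Hf as [c [d Hf]]. exists c, d. intros h Hh. simpl. rewrite Cmult_1_l. auto.
  - destruct (analytic_id_mult _ _ IH) as [c [d H]]. exists c, d. intros h Hh.
    rewrite Cpow_S, <- Cmult_assoc. auto.
Qed.

Lemma analytic_poly (p : nat -> C) n z0 :
  analytic_at (fun z => Csum (fun j => p j * z ^ j) n) z0.
Proof.
  assert (Hmon : forall j, analytic_at (fun z => p j * z ^ j) z0).
  { intros j. destruct (analytic_pow_mult j _ _ (analytic_const (p j) z0)) as [c [d H]].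
    exists c, d. intros h Hh. rewrite Cmult_comm. auto. }
  induction n as [|n IH].
  - destruct (Hmon 0%nat) as [c [d H]]. exists c, d. intros h Hh.
    rewrite Csum_O. auto.
  - destruct (analytic_plus _ _ _ IH (Hmon (S n))) as [c [d H]]. exists c, d.
    intros h Hh. rewrite Csum_S. auto.
Qed.

Lemma Cser_geom_le t l A :
  (0 <= A)%R -> (forall n, Cmod (t n) <= A * (/ 2) ^ n)%R -> Cser t l -> (Cmod l <= 2 * A)%R.
Proof.
  intros HA Ht Hl.
  assert (HG : is_series (fun n => (/ 2) ^ n)%R (/ (1 - / 2))%R)
    by (apply is_series_geom; rewrite Rabs_pos_eq; lra).
  assert (Hpos : forall n, (0 <= (/ 2) ^ n)%R) by (intros n; apply pow_le; lra).
  assert (H := series_remainder_le t l _ A _ 0 HA Hpos Ht HG Hl).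
  rewrite Csum_O, sum_O in H. simpl in H.
  replace l with ((l - t 0%nat) + t 0%nat) by ring.
  eapply Rle_trans; [apply Cmod_triangle|].
  specialize (Ht 0%nat). simpl in Ht.
  replace (/ (1 - / 2) - 1)%R with 1%R in H by field. lra.
Qed.

(** The sum is known to vanish only on a ray. Once the coefficients below n are 0, the n-th term
    equals minus the sum of the later ones, which is smaller by a factor of order th when s is
    scaled by th; th -> 0 forces it to be 0. *)
Lemma power_series_zero_coef (c : nat -> C) (w : C) (eps : R) :
  w <> 0 -> (0 < eps)%R ->
  (forall s, (0 < s < eps)%R -> Cser (fun n => (RtoC s * w) ^ n * c n) 0) ->
  forall n, c n = 0.
Proof.
  intros Hw Heps H n. induction n as [n IH] using lt_wf_ind.
  set (s0 := (eps / 2)%R).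
  assert (Hs0 : (0 < s0 < eps)%R) by (unfold s0; lra).
  set (g := fun i => (RtoC s0 * w) ^ i * c i).
  destruct (Cser_terms_bounded g 0 (H s0 Hs0)) as [B [HB Hg]].
  assert (Hle : forall th, (0 < th <= / 2)%R -> (Cmod (g n) <= 2 * (B * th))%R).
  { intros th Hth.
    assert (Hs : (0 < th * s0 < eps)%R) by nra.
    assert (HC := H (th * s0)%R Hs).
    assert (Ei : forall i, (RtoC (th * s0) * w) ^ i * c i = RtoC th ^ i * g i).
    { intros i. unfold g. rewrite RtoC_mult, !Cpow_mult_l. ring. }
    apply (Cser_ext _ _ _ Ei) in HC.
    set (u := fun i => RtoC th ^ i * g i) in HC.
    assert (Hsum : Csum u n = u n).
    { destruct n as [|n]; [apply Csum_O|]. rewrite Csum_S.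
      rewrite (Csum_ext u (fun _ => 0 * 0) n), Csum_scal; [ring|].
      intros i Hi. unfold u, g. rewrite (IH i) by lia. ring. }
    (* The partial sum up to n is [u n] alone, so the remaining tail sums to [- u n]. *)
    replace (RtoC 0) with (Csum u n + - u n) in HC by (rewrite Hsum; ring).
    apply Cser_shift_n in HC.
    assert (Hmod : forall i, Cmod (u i) = (th ^ i * Cmod (g i))%R).
    { intros i. unfold u. rewrite Cmod_mult, Cmod_pow, Cmod_R, Rabs_pos_eq by lra. ring. }
    assert (HA : (0 <= B * th ^ S n)%R) by (apply Rmult_le_pos; [lra | apply pow_le; lra]).
    assert (Hterm : forall i, (Cmod (u (n + S i)%nat) <= B * th ^ S n * (/ 2) ^ i)%R).
    { intros i. rewrite Hmod. replace (n + S i)%nat with (S n + i)%nat by lia.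
      rewrite pow_add.
      replace (B * th ^ S n * (/ 2) ^ i)%R with (th ^ S n * (/ 2) ^ i * B)%R by ring.
      apply Rmult_le_compat; [apply Rmult_le_pos; apply pow_le; lra | apply Cmod_ge_0 | |apply Hg].
      apply Rmult_le_compat_l; [apply pow_le; lra | apply pow_incr; lra]. }
    assert (Hb := Cser_geom_le _ _ _ HA Hterm HC).
    rewrite Cmod_opp, Hmod in Hb. simpl in Hb.
    assert (0 < th ^ n)%R by (apply pow_lt; lra).
    apply Rmult_le_reg_l with (th ^ n)%R; [assumption|].
    replace (th ^ n * (2 * (B * th)))%R with (2 * (B * (th * th ^ n)))%R by ring.
    exact Hb. }
  assert (Hgn : g n = 0).
  { apply Cmod_eq_0. apply Rle_antisym; [|apply Cmod_ge_0].
    apply le_epsilon. intros e He. rewrite Rplus_0_l.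
    (* At most 1/2, so that the tail is dominated by a geometric series of ratio 1/2, and small
       enough for 2 B th <= e. *)
    set (th := Rmin (/ 2) (e / (2 * B))).
    assert (0 < e / (2 * B))%R by (apply Rdiv_lt_0_compat; lra).
    eapply Rle_trans; [apply (Hle th)|].
    - split; [apply Rmin_glb_lt; lra | apply Rmin_l].
    - apply Rle_trans with (2 * (B * (e / (2 * B))))%R.
      + apply Rmult_le_compat_l; [lra|]. apply Rmult_le_compat_l; [lra|]. apply Rmin_r.
      + right. field. lra. }
  assert (Hne : (RtoC s0 * w) ^ n <> 0).
  { apply Cpow_nz, Cmult_neq_0; [|exact Hw]. intros E. apply RtoC_inj in E. lra. }
  replace (c n) with (g n / (RtoC s0 * w) ^ n) by (unfold g; field; exact Hne).
  rewrite Hgn. field. exact Hne.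
Qed.

Lemma analytic_zero_continuation (H : C -> C) (z0 w : C) (eps : R) :
  analytic_at H z0 -> w <> 0 -> (0 < eps)%R ->
  (forall s, (0 < s < eps)%R -> H (z0 + RtoC s * w) = 0) ->
  exists d : posreal, forall h, (Cmod h < d)%R -> H (z0 + h) = 0.
Proof.
  intros [c [d Hc]] Hw Heps H0. exists d.
  assert (Hmw : (0 < Cmod w)%R) by now apply Cmod_gt_0.
  assert (Hd := cond_pos d).
  assert (Hz : forall n, c n = 0).
  { apply (power_series_zero_coef c w (Rmin eps (d / Cmod w)) Hw).
    - apply Rmin_glb_lt; [exact Heps | now apply Rdiv_lt_0_compat].
    - intros s [Hs1 Hs2].
      assert (Hs3 := Rlt_le_trans _ _ _ Hs2 (Rmin_l _ _)).
      assert (Hs4 := Rlt_le_trans _ _ _ Hs2 (Rmin_r _ _)).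
      rewrite <- (H0 s) by lra. apply is_pseries_Cser, Hc.
      rewrite Cmod_mult, Cmod_R, Rabs_pos_eq by lra.
      apply Rmult_lt_reg_r with (/ Cmod w)%R; [now apply Rinv_0_lt_compat|].
      rewrite Rmult_assoc, Rinv_r by lra. unfold Rdiv in Hs4. lra. }
  intros h Hh. specialize (Hc h Hh). apply (proj1 (is_pseries_Cser _ _ _)) in Hc.
  apply (Cser_unique _ _ _ Hc). apply Cser_ext with (2 := Cser_zero).
  intros n. rewrite Hz. ring.
Qed.

(** Connectedness of [0,1] by a least upper bound S: the zeros just below S make the expansion at S
    y vanish identically, so the zeros continue beyond S unless S = 1. *)
Lemma identity_on_segment (H : C -> C) (y : C) (eps : R) :
  (forall t, (0 <= t <= 1)%R -> analytic_at H (RtoC t * y)) ->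
  (0 < eps)%R -> (forall z, (Cmod z < eps)%R -> H z = 0) ->
  H y = 0.
Proof.
  intros Han Heps H0.
  destruct (Ceq_dec y 0) as [->|Hy].
  { apply H0. rewrite Cmod_0. exact Heps. }
  assert (Hmy : (0 < Cmod y)%R) by now apply Cmod_gt_0.
  set (E := fun s => (0 <= s <= 1)%R /\ forall t, (0 <= t <= s)%R -> H (RtoC t * y) = 0).
  assert (HE0 : exists s, (0 < s)%R /\ E s).
  { exists (Rmin 1 (eps / Cmod y / 2)).
    assert (Hq : (0 < eps / Cmod y)%R) by now apply Rdiv_lt_0_compat.
    assert (Hp : (0 < Rmin 1 (eps / Cmod y / 2))%R) by (apply Rmin_glb_lt; lra).
    split; [exact Hp|]. split; [split; [lra | apply Rmin_l]|].
    intros t Ht. apply H0. rewrite Cmod_mult, Cmod_R, Rabs_pos_eq by lra.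
    assert (t <= eps / Cmod y / 2)%R by (eapply Rle_trans; [apply Ht | apply Rmin_r]).
    apply Rmult_lt_reg_r with (/ Cmod y)%R; [now apply Rinv_0_lt_compat|].
    rewrite Rmult_assoc, Rinv_r by lra. unfold Rdiv in *. lra. }
  destruct HE0 as [s1 [Hs1 HEs1]].
  destruct (completeness E) as [S [Hub Hlub]].
  { exists 1%R. intros s Hs. apply Hs. }
  { exists s1. exact HEs1. }
  assert (HS : (0 < S <= 1)%R).
  { split; [apply Rlt_le_trans with s1; [exact Hs1 | now apply Hub]|].
    apply Hlub. intros s Hs. apply Hs. }
  assert (Hbelow : forall t, (0 <= t < S)%R -> H (RtoC t * y) = 0).
  { intros t Ht. apply NNPP. intros Hne.
    apply (Rlt_not_le S t); [apply Ht|]. apply Hlub. intros s [_ Hs].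
    apply Rnot_lt_le. intros Hts. apply Hne, Hs. lra. }
  (* Direction -y: from S y one looks back along the part of the segment where H is known to
     vanish. *)
  destruct (analytic_zero_continuation H (RtoC S * y) (- y) S) as [d Hd].
  - apply Han. lra.
  - intros Ey. apply Hy. replace y with (- - y) by ring. rewrite Ey. ring.
  - lra.
  - intros s Hs. replace (RtoC S * y + RtoC s * - y) with (RtoC (S - s) * y)
      by (rewrite RtoC_minus; ring).
    apply Hbelow. lra.
  - assert (Hd0 := cond_pos d).
    assert (Hq : (0 < d / Cmod y)%R) by now apply Rdiv_lt_0_compat.
    assert (Habove : forall t, (S <= t < S + d / Cmod y)%R -> H (RtoC t * y) = 0).
    { intros t Ht. replace (RtoC t * y) with (RtoC S * y + RtoC (t - S) * y)
        by (rewrite RtoC_minus; ring).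
      apply Hd. rewrite Cmod_mult, Cmod_R, Rabs_pos_eq by lra.
      apply Rmult_lt_reg_r with (/ Cmod y)%R; [now apply Rinv_0_lt_compat|].
      rewrite Rmult_assoc, Rinv_r by lra. unfold Rdiv in *. lra. }
    destruct (Req_dec S 1) as [E1|N1].
    + replace y with (RtoC 1 * y) by ring. apply Habove. lra.
    + exfalso. set (s := Rmin 1 (S + d / Cmod y / 2)).
      assert (Hs : (S < s)%R) by (apply Rmin_glb_lt; lra).
      apply (Rlt_not_le _ _ Hs). apply Hub.
      split; [split; [lra | apply Rmin_l]|].
      intros t Ht. destruct (Rlt_le_dec t S) as [HtS|HtS].
      * apply Hbelow. lra.
      * apply Habove. split; [exact HtS|].
        assert (t <= S + d / Cmod y / 2)%R by (eapply Rle_trans; [apply Ht | apply Rmin_r]).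
        lra.
Qed.

(** * Coefficients of the transformed series *)

Lemma Cprod_cons z l : Cprod (z :: l) = z * Cprod l.
Proof. reflexivity. Qed.

Lemma Cprod_map_mult {T : Type} (g h : T -> C) l :
  Cprod (map (fun i => g i * h i) l) = Cprod (map g l) * Cprod (map h l).
Proof.
  induction l as [|i l IH]; cbn [map].
  - simpl. ring.
  - rewrite !Cprod_cons, IH. ring.
Qed.

Lemma Cprod_map_ext {T : Type} (g h : T -> C) l :
  (forall i, In i l -> g i = h i) -> Cprod (map g l) = Cprod (map h l).
Proof. intros H. f_equal. now apply map_ext_in. Qed.

Lemma Cprod_map_neq_0 {T : Type} (g : T -> C) l :
  (forall i, In i l -> g i <> 0) -> Cprod (map g l) <> 0.
Proof.
  induction l as [|i l IH]; intros H; simpl.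
  - apply C1_nz.
  - apply Cmult_neq_0; [apply H; now left|]. apply IH. intros i' Hi. apply H. now right.
Qed.

Lemma Cprod_map_div {T : Type} (g h : T -> C) l :
  (forall i, In i l -> h i <> 0) ->
  Cprod (map (fun i => g i / h i) l) = Cprod (map g l) / Cprod (map h l).
Proof.
  intros H. assert (Hn := Cprod_map_neq_0 h l H).
  assert (E : Cprod (map (fun i => g i / h i) l) * Cprod (map h l) = Cprod (map g l)).
  { rewrite <- Cprod_map_mult. apply Cprod_map_ext. intros i Hi. field. now apply H. }
  rewrite <- E. field. exact Hn.
Qed.

Lemma in_seq_1 i r : In i (seq 1 r) -> (1 <= i <= r)%nat.
Proof. intros H. apply in_seq in H. lia. Qed.

Lemma map_vec {T U : Type} (g : T -> U) (u : nat -> T) r :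
  map g (vec u r) = vec (fun i => g (u i)) r.
Proof. apply map_map. Qed.

(** The function W(n) of the overview, written as in the definition of C_{k,r}. *)
Definition shift_ratio (r : nat) (mm : nat -> nat) (f : nat -> C) (n : nat) : C :=
  Cprod (vec (fun j => poch (f j + NtoC (mm j)) n / poch (f j) n) r).

Lemma fdiff_const x k : fdiff (S k) (fun _ => x) = 0.
Proof. simpl. ring. Qed.

Lemma fdiff_poch_factor w d z p :
  (forall k, (d < k)%nat -> fdiff k w = 0) ->
  forall k, (p + d < k)%nat -> fdiff k (fun n => poch (z + NtoC n) p * w n) = 0.
Proof.
  intros Hw. induction p as [|p IH]; intros k Hk.
  - rewrite (fdiff_ext _ _ w); [apply Hw; lia|]. intros n. simpl. ring.
  - rewrite (fdiff_ext _ _ (fun n => (z + NtoC p + NtoC n) * (poch (z + NtoC n) p * w n))).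
    + now apply fdiff_linear_factor with (p + d)%nat.
    + intros n. rewrite poch_S. ring.
Qed.

(** The j-th factor is a polynomial of degree m_j in n; [g] only carries normalising constants. *)
Lemma fdiff_poch_product (mm : nat -> nat) (f g : nat -> C) l k :
  (list_sum (map mm l) < k)%nat ->
  fdiff k (fun n => Cprod (map (fun j => poch (f j + NtoC n) (mm j) / g j) l)) = 0.
Proof.
  revert k. induction l as [|j l IH]; intros k Hk; simpl in *.
  - destruct k; [lia | apply fdiff_const].
  - rewrite (fdiff_ext _ _ (fun n => / g j * (poch (f j + NtoC n) (mm j) *
      Cprod (map (fun j => poch (f j + NtoC n) (mm j) / g j) l)))).
    + rewrite fdiff_scal. rewrite (fdiff_poch_factor _ _ (f j) (mm j) IH k Hk). ring.
    + intros n. unfold Cdiv, Cprod. ring.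
Qed.

(** Splitting (f)_{n+m} in both orders gives (f)_m (f+m)_n = (f)_n (f+n)_m, which moves n out of the
    length of the factorial and exhibits a polynomial in n. *)
Lemma shift_ratio_poly r mm f n :
  (forall j, (1 <= j <= r)%nat -> ~ nonpos_int (f j)) ->
  shift_ratio r mm f n =
  Cprod (map (fun j => poch (f j + NtoC n) (mm j) / poch (f j) (mm j)) (seq 1 r)).
Proof.
  intros Hf. apply Cprod_map_ext. intros j Hj. apply in_seq_1 in Hj.
  assert (H1 := poch_neq_0 (f j) n (Hf j Hj)).
  assert (H2 := poch_neq_0 (f j) (mm j) (Hf j Hj)).
  assert (E : poch (f j) (mm j) * poch (f j + NtoC (mm j)) n =
              poch (f j) n * poch (f j + NtoC n) (mm j))
    by (rewrite <- !poch_plus; f_equal; lia).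
  replace (poch (f j + NtoC (mm j)) n) with
    (poch (f j) (mm j) * poch (f j + NtoC (mm j)) n / poch (f j) (mm j))
    by (field; exact H2).
  rewrite E. field. split; assumption.
Qed.

Lemma fdiff_shift_ratio r mm f k :
  (forall j, (1 <= j <= r)%nat -> ~ nonpos_int (f j)) ->
  (total mm r < k)%nat -> fdiff k (shift_ratio r mm f) = 0.
Proof.
  intros Hf Hk. rewrite (fdiff_ext _ _ _ (fun n => shift_ratio_poly r mm f n Hf)).
  now apply fdiff_poch_product.
Qed.

Lemma Ckr_fdiff r mm f k :
  Ckr r mm f k = (- (1)) ^ k / NtoC (fact k) * fdiff k (shift_ratio r mm f).
Proof. rewrite fdiff_sum. reflexivity. Qed.

Lemma Ckr_zero r mm f k :
  (forall j, (1 <= j <= r)%nat -> ~ nonpos_int (f j)) ->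
  (total mm r < k)%nat -> Ckr r mm f k = 0.
Proof. intros Hf Hk. rewrite Ckr_fdiff, fdiff_shift_ratio by assumption. ring. Qed.

(** Leibniz' rule with u(n) = (b)_n/(c)_n: its shift by k is a constant times the same quotient for
    b+k, c+k, so Vandermonde's sum always yields (c-b)_{j-k} and the denominators combine into
    (c)_j. *)
Lemma fdiff_poch_ratio_mult j b c w : ~ nonpos_int c ->
  fdiff j (fun n => poch b n / poch c n * w n) =
  / poch c j * Csum (fun k => poch b k * ((- (1)) ^ k / NtoC (fact k) * fdiff k w) *
    poch (- NtoC j) k * poch (c - b) (j - k)) j.
Proof.
  intros Hc. rewrite fdiff_mult, <- Csum_scal. apply Csum_ext. intros k Hk.
  rewrite (fdiff_ext (j - k) (fun n => poch b (k + n) / poch c (k + n))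
    (fun n => poch b k / poch c k * (poch (b + NtoC k) n / poch (c + NtoC k) n))).
  - rewrite fdiff_scal, vandermonde by now apply nonpos_int_shift.
    replace (c + NtoC k - (b + NtoC k)) with (c - b) by ring.
    replace (poch c j) with (poch c k * poch (c + NtoC k) (j - k))
      by (rewrite <- poch_plus; f_equal; lia).
    field. repeat split; try apply NtoC_fact_neq_0;
      apply poch_neq_0; [now apply nonpos_int_shift | exact Hc].
  - intros n. rewrite !poch_plus. field.
    split; apply poch_neq_0; [now apply nonpos_int_shift | exact Hc].
Qed.

(** The expansion at y0 = 0. The factor (a)_n (a+n)_{j-n} = (a)_j comes out of the sum, and what
    remains is the binomial expansion of a difference. *)
Lemma pfaff_coef_1 a w j :
  pfaff_coef a 1 (fun n => binom_coef a n * w n) j = binom_coef a j * fdiff j w.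
Proof.
  assert (H1 : cut_plane 1).
  { unfold cut_plane. rewrite Cmod_1. simpl. lra. }
  assert (E1 : / (1) = RtoC 1) by field.
  (* 1 is its own inverse, so Clog 1 equals its own negative. *)
  assert (E0 : Clog 1 = 0).
  { assert (E := Clog_inv 1 H1). rewrite E1 in E.
    replace (Clog 1) with ((Clog 1 - - Clog 1) / 2) by field.
    rewrite <- E. field. }
  assert (E2 : Cexp (- a * Clog 1) = 1).
  { rewrite E0. replace (- a * 0) with (RtoC 0) by ring.
    unfold Cexp. simpl. rewrite exp_0, cos_0, sin_0. unfold RtoC. f_equal; ring. }
  unfold pfaff_coef. rewrite E2, E1, Cmult_1_l, fdiff_sum, <- Csum_scal.
  apply Csum_ext. intros n Hn. rewrite Cpow_1_l, (poch_opp_nat_fact j n Hn).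
  unfold binom_coef.
  replace (poch a j) with (poch a n * poch (a + NtoC n) (j - n))
    by (rewrite <- poch_plus; f_equal; lia).
  field. repeat split; apply NtoC_fact_neq_0.
Qed.

Lemma hyp_coef_top r mm f a b c n :
  (forall j, (1 <= j <= r)%nat -> ~ nonpos_int (f j)) -> ~ nonpos_int c ->
  hyp_coef (a :: b :: vec (fun j => f j + NtoC (mm j)) r) (c :: vec f r) n =
  binom_coef a n * (poch b n / poch c n * shift_ratio r mm f n).
Proof.
  intros Hf Hc. unfold hyp_coef. cbn [map]. rewrite !map_vec.
  unfold shift_ratio, vec, binom_coef.
  assert (Hn : forall i, In i (seq 1 r) -> poch (f i) n <> 0).
  { intros i Hi. apply poch_neq_0, Hf. now apply in_seq_1. }
  rewrite Cprod_map_div, !Cprod_cons by exact Hn.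
  field. repeat split.
  - apply (Cprod_map_neq_0 _ _ Hn).
  - now apply poch_neq_0.
  - apply NtoC_fact_neq_0.
Qed.

(** Both sums are compared with the sum up to m + j. Terms with k > m vanish through C_{k,r}; for j
    < k <= m the factorial is (-(k-j-1))_{m-q-1}, which is 0 since k-j-1 < m-q-1. This is where j >
    q enters. *)
Lemma Rpol_trunc r mm f b q j :
  (forall j, (1 <= j <= r)%nat -> ~ nonpos_int (f j)) ->
  (q < total mm r)%nat -> (q < j)%nat ->
  Rpol r mm f b q (- NtoC j) =
  Csum (fun k => poch b k * Ckr r mm f k * (- (1)) ^ k *
    poch (1 - - NtoC j - NtoC k) (total mm r - q - 1)) j.
Proof.
  intros Hf Hq Hj. set (m := total mm r) in *.
  set (u := fun k => poch b k * Ckr r mm f k * (- (1)) ^ k *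
    poch (1 - - NtoC j - NtoC k) (m - q - 1)).
  change (Csum u m = Csum u j).
  assert (Hm : forall k, (m < k)%nat -> u k = 0).
  { intros k Hk. unfold u. rewrite Ckr_zero by assumption. ring. }
  rewrite <- (Csum_trunc u m j Hm), <- (Csum_trunc u j m), Nat.add_comm; [reflexivity|].
  intros k Hk. destruct (Nat.lt_ge_cases m k) as [Hmk|Hmk]; [now apply Hm|].
  unfold u. replace (1 - - NtoC j - NtoC k) with (- NtoC (k - j - 1)).
  - rewrite poch_opp_nat_zero by lia. ring.
  - rewrite !NtoC_minus by lia. change (NtoC 1) with (RtoC 1). ring.
Qed.

(** Termwise for k <= j: (-j)_k = (-1)^k j!/(j-k)!, (m-q)_{j-k} = (m-q-1+j-k)!/(m-q-1)!, and the
    quotient of the factorials depending on k is (j-k+1)_{m-q-1}. *)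
Lemma Rpol_opp_nat r mm f b q j :
  (forall j, (1 <= j <= r)%nat -> ~ nonpos_int (f j)) ->
  (q < total mm r)%nat -> (q < j)%nat ->
  Csum (fun k => poch b k * Ckr r mm f k * poch (- NtoC j) k *
    poch (NtoC (total mm r) - NtoC q) (j - k)) j =
  NtoC (fact j) / NtoC (fact (total mm r - q - 1)) * Rpol r mm f b q (- NtoC j).
Proof.
  intros Hf Hq Hj. rewrite Rpol_trunc, <- Csum_scal by assumption.
  set (m := total mm r) in *.
  apply Csum_ext. intros k Hk.
  replace (NtoC m - NtoC q) with (NtoC (m - q - 1) + 1)
    by (rewrite !NtoC_minus by lia; change (NtoC 1) with (RtoC 1); ring).
  replace (1 - - NtoC j - NtoC k) with (NtoC (j - k) + 1)
    by (rewrite !NtoC_minus by lia; ring).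
  rewrite !poch_nat_fact, poch_opp_nat_fact by exact Hk.
  rewrite (Nat.add_comm (j - k)). field. split; apply NtoC_fact_neq_0.
Qed.

Lemma slit_cut_plane z : slit z <-> cut_plane (1 - z).
Proof.
  rewrite cut_plane_iff. unfold slit.
  replace (Im (1 - z)) with (- Im z)%R by (unfold Im; simpl; ring).
  replace (Re (1 - z)) with (1 - Re z)%R by (unfold Re; simpl; ring).
  split; intros H [H1 H2]; apply H; split; lra.
Qed.

(** The slit plane is star-shaped about 0, so segments from 0 are enough for the continuation. *)
Lemma slit_segment y t : (0 <= t <= 1)%R -> slit y -> slit (RtoC t * y).
Proof.
  intros Ht Hy [H1 H2]. apply Hy.
  replace (Im (RtoC t * y)) with (t * Im y)%R in H1 by (unfold Im; simpl; ring).
  replace (Re (RtoC t * y)) with (t * Re y)%R in H2 by (unfold Re; simpl; ring).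
  split.
  - destruct (Rmult_integral _ _ H1) as [E|E]; [|exact E].
    rewrite E in H2. lra.
  - apply Rnot_lt_le. intros H3. destruct (Rle_dec 0 (Re y)); nra.
Qed.

(** With z = lam + q + 1, each factor -(z + i) equals -z (z+1)_i/(z)_i. This turns values of the
    factored polynomial into parameters of a hypergeometric series. *)
Lemma Rpol_recurrence (lam : nat -> C) n q i :
  (forall l, (1 <= l <= n)%nat -> ~ nonpos_int (lam l + NtoC q + 1)) ->
  Cprod (vec (fun l => - NtoC (q + S i) - lam l) n) =
  Cprod (vec (fun l => - NtoC q - 1 - lam l) n) *
  Cprod (vec (fun l => poch (lam l + NtoC q + 2) i) n) /
  Cprod (vec (fun l => poch (lam l + NtoC q + 1) i) n).
Proof.
  intros Hl.
  assert (Hn : forall l, In l (seq 1 n) -> poch (lam l + NtoC q + 1) i <> 0).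
  { intros l Hi. apply poch_neq_0, Hl. now apply in_seq_1. }
  unfold vec. rewrite <- Cprod_map_mult, <- Cprod_map_div by exact Hn.
  apply Cprod_map_ext. intros l Hi. specialize (Hn l Hi).
  set (z := lam l + NtoC q + 1) in *.
  replace (lam l + NtoC q + 2) with (z + 1) by (unfold z; ring).
  replace ((- NtoC q - 1 - lam l) * poch (z + 1) i) with (- (z * poch (z + 1) i))
    by (unfold z; ring).
  rewrite <- poch_S_left, poch_S, NtoC_plus, NtoC_S. unfold z in *. field. exact Hn.
Qed.

Theorem theorem1
  (a b : C) (r : nat) (mm : nat -> nat) (f : nat -> C) (m q : nat)
  (hr : (1 <= r)%nat)
  (hmm : forall j : nat, (1 <= j <= r)%nat -> (1 <= mm j)%nat)
  (hm : m = total mm r)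
  (hf : forall j : nat, (1 <= j <= r)%nat -> ~ nonpos_int (f j))
  (hq : (q <= m - 1)%nat)
  (hb : ~ nonpos_int (b + NtoC m - NtoC q))
  (hfb : forall j : nat, (1 <= j <= r)%nat ->
     (Z.of_nat m - Z.of_nat q - Z.of_nat (mm j) <= 0)%Z ->
     forall z : Z,
       (Z.of_nat m - Z.of_nat q - Z.of_nat (mm j) <= z <= 0)%Z ->
       f j - b <> RtoC (IZR z)) :
  Rpol r mm f b q (- NtoC q - 1) =
    (- (1)) ^ (m - q + 1) *
    sum_n (fun k =>
      poch b k * Ckr r mm f k * (- (1)) ^ k *
      poch (NtoC k - NtoC m) (m - q - 1)) (q + 1)
  /\
  forall (lam : nat -> C) (kappa : C) (F G : C -> C),
    kappa <> 0 ->
    (forall t : C,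
       Rpol r mm f b q t =
       kappa * Cprod (vec (fun i => t - lam i) (m - q - 1))) ->
    (forall i : nat, (1 <= i <= m - q - 1)%nat ->
       ~ nonpos_int (lam i + NtoC q + 1)) ->
    is_hypergeom
      (a :: b :: vec (fun j => f j + NtoC (mm j)) r)
      ((b + NtoC m - NtoC q) :: vec f r) F ->
    is_hypergeom
      (RtoC 1 :: (a + NtoC q + 1) ::
         vec (fun i => lam i + NtoC q + 2) (m - q - 1))
      ((b + NtoC m + 1) ::
         vec (fun i => lam i + NtoC q + 1) (m - q - 1)) G ->
    forall x : C, slit x ->
      Cpower (1 - x) a * F x =
        sum_n (fun j =>
          poch a j * poch (- NtoC q) j * Q0neg r mm f b q j
          / (poch (b + NtoC m - NtoC q) j * NtoC (fact j))
          * (x / (x - 1)) ^ j) q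
        + x ^ (q + 1) * poch a (q + 1) * Rpol r mm f b q (- NtoC q - 1)
          / ((x - 1) ^ (q + 1) * poch (b + NtoC m - NtoC q) (q + 1)
             * NtoC (fact (m - q - 1)))
          * G (x / (x - 1)).
Proof.
  (* Subtraction on [nat] is truncated, so q <= m - 1 gives q < m only once m >= 1 is known. *)
  assert (hqm : (q < total mm r)%nat).
  { assert (1 <= total mm r)%nat; [|lia].
    destruct r as [|r]; [lia|]. specialize (hmm 1%nat ltac:(lia)).
    unfold total, vec. simpl. lia. }
  assert (Et : - NtoC q - 1 = - NtoC (q + 1)).
  { rewrite NtoC_plus. change (NtoC 1) with (RtoC 1). ring. }
  split.
  { change (Rpol r mm f b q (- NtoC q - 1) =
      (- (1)) ^ (m - q + 1) *
      Csum (fun k => poch b k * Ckr r mm f k * (- (1)) ^ k *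
        poch (NtoC k - NtoC m) (m - q - 1)) (q + 1)).
    rewrite Et, Rpol_trunc, <- Csum_scal by (assumption || lia). rewrite <- hm.
    apply Csum_ext. intros k Hk. rewrite (poch_reflect (1 - _ - _)).
    (* Reflection produces the exponent m-q-1, of the same parity as m-q+1. *)
    replace (m - q + 1)%nat with (m - q - 1 + 2)%nat by lia. rewrite Cpow_add_r.
    replace (1 - (1 - - NtoC (q + 1) - NtoC k) - NtoC (m - q - 1)) with (NtoC k - NtoC m)
      by (rewrite !NtoC_minus, NtoC_plus by lia; change (NtoC 1) with (RtoC 1); ring).
    simpl. ring. }
  intros lam kappa F G _ HR Hlam [HF HFa] [HG HGa] x Hx.
  set (c := b + NtoC m - NtoC q) in *.
  set (g := fun n => poch b n / poch c n * shift_ratio r mm f n).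
  set (num := fun j => Csum (fun k => poch b k * Ckr r mm f k * poch (- NtoC j) k *
    poch (NtoC m - NtoC q) (j - k)) j).
  assert (Hg : forall j, fdiff j g = num j / poch c j).
  { intros j. unfold g. rewrite fdiff_poch_ratio_mult by exact hb.
    unfold num, Cdiv. rewrite Cmult_comm. f_equal. apply Csum_ext. intros k Hk.
    rewrite Ckr_fdiff. unfold c.
    replace (b + NtoC m - NtoC q - b) with (NtoC m - NtoC q) by ring. reflexivity. }
  set (p := fun j => poch a j * poch (- NtoC q) j * Q0neg r mm f b q j
    / (poch c j * NtoC (fact j))).
  (* The coefficient of y^(q+1), the first one beyond the finite sum; the later ones are K times the
     coefficients of the second series. *)
  set (K := poch a (q + 1) * Rpol r mm f b q (- NtoC q - 1) /
    (poch c (q + 1) * NtoC (fact (m - q - 1)))).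
  set (gam := hyp_coef
      (RtoC 1 :: (a + NtoC q + 1) ::
         vec (fun i => lam i + NtoC q + 2) (m - q - 1))
      ((b + NtoC m + 1) ::
         vec (fun i => lam i + NtoC q + 1) (m - q - 1))) in *.
  assert (Hp : forall j, (j <= q)%nat -> binom_coef a j * fdiff j g = p j).
  { intros j Hj. rewrite Hg. unfold p, Q0neg. cbv zeta. rewrite <- hm.
    change (sum_n _ j) with (num j). unfold binom_coef.
    assert (H1 := poch_opp_nat_neq_0 q j Hj).
    assert (H2 := poch_neq_0 c j hb). assert (H3 := NtoC_fact_neq_0 j).
    field. repeat split; assumption. }
  assert (HK : forall i, binom_coef a (q + S i) * fdiff (q + S i) g = K * gam i).
  { intros i.
    assert (HO := Rpol_opp_nat r mm f b q (q + S i) hf hqm ltac:(lia)).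
    rewrite <- hm in HO. fold (num (q + S i)%nat) in HO.
    rewrite Hg, HO, HR.
    unfold K. rewrite HR, (Rpol_recurrence lam _ q i Hlam).
    unfold gam, hyp_coef. cbn [map]. rewrite !map_vec, !Cprod_cons.
    unfold binom_coef.
    (* The top parameter 1 cancels the i! in the denominator of the hypergeometric coefficient. *)
    replace (poch 1 i) with (NtoC (fact i)).
    2:{ replace (RtoC 1) with (NtoC 0 + 1) by (change (NtoC 0) with (RtoC 0); ring).
        rewrite poch_nat_fact. simpl. change (NtoC 1) with (RtoC 1). field. }
    replace (q + S i)%nat with (q + 1 + i)%nat by lia.
    rewrite !(poch_plus _ (q + 1) i).
    replace (a + NtoC (q + 1)) with (a + NtoC q + 1)
      by (rewrite NtoC_plus; change (NtoC 1) with (RtoC 1); ring).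
    replace (c + NtoC (q + 1)) with (b + NtoC m + 1)
      by (unfold c; rewrite NtoC_plus; change (NtoC 1) with (RtoC 1); ring).
    assert (H1 : Cprod (vec (fun l => poch (lam l + NtoC q + 1) i) (m - q - 1)) <> 0).
    { apply Cprod_map_neq_0. intros l Hl. apply poch_neq_0, Hlam. now apply in_seq_1. }
    assert (H2 : poch (b + NtoC m + 1) i <> 0).
    { apply poch_neq_0. replace (b + NtoC m + 1) with (c + NtoC (q + 1))
        by (unfold c; rewrite NtoC_plus; change (NtoC 1) with (RtoC 1); ring).
      now apply nonpos_int_shift. }
    assert (H3 := poch_neq_0 c (q + 1) hb).
    assert (H4 := NtoC_fact_neq_0 i). assert (H5 := NtoC_fact_neq_0 (m - q - 1)).
    assert (H6 := NtoC_fact_neq_0 (q + 1 + i)).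
    field. repeat split; assumption. }
  (* The difference of the two sides in the variable y, with 1 - x = 1/(1 - y); the shape sum plus
     scalar multiple fits the closure lemmas for [analytic_at]. *)
  set (H := fun z => Cpower (/ (1 - z)) a * F (1 - / (1 - z)) +
    - (1) * (Csum (fun j => p j * z ^ j) q + K * (z ^ (q + 1) * G z))).
  assert (Hx1 : x - 1 <> 0).
  { intros E. apply slit_cut_plane, cut_plane_neq_0 in Hx. apply Hx.
    replace (1 - x) with (- (x - 1)) by ring. rewrite E. ring. }
  assert (Ey : / (1 - x / (x - 1)) = 1 - x).
  { replace (1 - x / (x - 1)) with (/ (1 - x)).
    - field. intros E. apply Hx1. replace (x - 1) with (- (1 - x)) by ring.
      rewrite E. ring.
    - field. split; [exact Hx1|]. intros E. apply Hx1.
      replace (x - 1) with (- (1 - x)) by ring. rewrite E. ring. }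
  assert (Hy : slit (x / (x - 1))).
  { apply slit_cut_plane. apply slit_cut_plane in Hx.
    replace (1 - x / (x - 1)) with (/ (1 - x)); [now apply cut_plane_inv|].
    field. split; [exact Hx1 | now apply cut_plane_neq_0]. }
  assert (HHy : H (x / (x - 1)) = 0).
  { assert (Hc1 : cut_plane 1).
    { unfold cut_plane. rewrite Cmod_1. simpl. lra. }
    destruct (pfaff_local a 1 F (fun n => binom_coef a n * g n) 1 Hc1 Rlt_0_1) as [d Hd].
    { intros h Hh. replace (1 - / (1) + h) with h by field.
      specialize (HF h Hh). apply (proj1 (is_pseries_Cser _ _ _)) in HF.
      apply Cser_ext with (2 := HF). intros n.
      now rewrite hyp_coef_top by assumption. }
    (* Within d the Pfaff expansion at 0 converges; within 1 the series of G does. *)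
    apply identity_on_segment with (Rmin d 1).
    - intros t Ht. assert (Hs := slit_segment _ t Ht Hy).
      set (z0 := RtoC t * (x / (x - 1))) in *.
      assert (Hv := proj1 (slit_cut_plane z0) Hs).
      apply analytic_plus.
      + destruct (HFa (1 - / (1 - z0))) as [e [d0 He]].
        { apply slit_cut_plane. replace (1 - (1 - / (1 - z0))) with (/ (1 - z0)) by ring.
          now apply cut_plane_inv. }
        destruct (pfaff_local a (1 - z0) F e d0 Hv (cond_pos d0)) as [d1 Hd1].
        { intros h Hh. now apply is_pseries_Cser, He. }
        exists (pfaff_coef a (1 - z0) e), d1. intros k Hk.
        apply is_pseries_Cser.
        replace (1 - (z0 + k)) with (1 - z0 - k) by ring. now apply Hd1.
      + apply analytic_scal, analytic_plus; [apply analytic_poly|].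
        apply analytic_scal, analytic_pow_mult, HGa, Hs.
    - apply Rmin_glb_lt; [apply cond_pos | lra].
    - intros z Hz. unfold H.
      assert (H1 := Hd z (Rlt_le_trans _ _ _ Hz (Rmin_l _ _))).
      assert (H2 := HG z (Rlt_le_trans _ _ _ Hz (Rmin_r _ _))).
      apply (proj1 (is_pseries_Cser _ _ _)) in H2.
      set (u := fun j => z ^ j * (binom_coef a j * fdiff j g)).
      (* The right side has the same power series as the left: [HK] identifies the terms of index
         above q, [Hp] the others. *)
      assert (H3 : Cser u (Csum u q + K * (z ^ (q + 1) * G z))).
      { apply Cser_shift_n.
        replace (K * (z ^ (q + 1) * G z)) with (K * z ^ (q + 1) * G z) by ring.
        apply Cser_ext with (2 := Cser_scal (K * z ^ (q + 1)) _ _ H2).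
        intros i. unfold u. rewrite HK.
        replace (q + S i)%nat with (q + 1 + i)%nat by lia.
        rewrite (Cpow_add_r z (q + 1) i). ring. }
      apply (Cser_ext _ u) in H1; [|intros j; unfold u; now rewrite <- pfaff_coef_1].
      rewrite (Cser_unique _ _ _ H1 H3).
      rewrite (Csum_ext u (fun j => p j * z ^ j)); [ring|].
      intros j Hj. unfold u. rewrite (Hp j Hj). ring. }
  unfold H in HHy. rewrite Ey in HHy.
  replace (1 - (1 - x)) with x in HHy by ring.
  set (X := Cpower (1 - x) a * F x) in *.
  set (Y := G (x / (x - 1))) in *.
  change (X = Csum (fun j => p j * (x / (x - 1)) ^ j) q +
    x ^ (q + 1) * poch a (q + 1) * Rpol r mm f b q (- NtoC q - 1)
    / ((x - 1) ^ (q + 1) * poch c (q + 1) * NtoC (fact (m - q - 1))) * Y).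
  set (P := Csum _ q) in *.
  replace X with ((X + - (1) * (P + K * ((x / (x - 1)) ^ (q + 1) * Y))) +
    (P + K * ((x / (x - 1)) ^ (q + 1) * Y))) by ring.
  rewrite HHy, Cplus_0_l. f_equal.
  unfold K, Cdiv. rewrite (Cpow_mult_l x), Cpow_inv by exact Hx1.
  field. repeat split; [apply NtoC_fact_neq_0 | now apply poch_neq_0 | now apply Cpow_nz].
Qed.
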